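(* Let $p$ be a prime, let $l,m\ge 1$ be integers, and let $a$ be an integer with $0\le a\le p^m-2$, with $p$-adic expansion $a=a_0+pa_1+\dots+p^{m-1}a_{m-1}$ ($0\le a_i\le p-1$). Set $s(a)=a_0+a_1+\dots+a_{m-1}$ and $p(a)=a_0!\,a_1!\cdots a_{m-1}!$. Then the Gauss sum $$G_{\mathcal{T}_m}(\chi^{-a},\tilde{\psi}_{l,m})=\sum_{x\in \mathcal{T}_m^*}\chi^{-a}(x)\,\tilde{\psi}_{l,m}(x)$$ satisfies the following congruence in $\mathcal{O}_{l,m}$: $$G_{\mathcal{T}_m}(\chi^{-a},\tilde{\psi}_{l,m})\equiv -\frac{\pi_l^{s(a)}}{p(a)} \pmod{\pi_l^{s(a)+1}}.$$
   Context: $\mathbb{C}_p$ is the completion of an algebraic closure of $\mathbb{Q}_p$, with valuation $v_p$ normalized by $v_p(p)=1$. For $x,y,z\in\mathbb{C}_p$, $x\equiv y\ [z]$ means $v_p(x-y)\ge v_p(z)$. Artin-Hasse series: $AH(X)=\sum_{i\ge 0}X^{p^i}/p^i\in\mathbb{Q}_p[[X]]$ (convergent for $v_p(x)>0$; its roots are taken in the open unit disk of $\mathbb{C}_p$). For each $k\ge1$ it has exactly $p^k-p^{k-1}$ roots in $\mathbb{C}_p$ of valuation $(p^k-p^{k-1})^{-1}$. Put $\pi_0=0$, and fix once and for all a compatible sequence $(\pi_l)_{l\ge 1}$: each $\pi_l$ is a root of $AH$ with $v_p(\pi_l)=(p^l-p^{l-1})^{-1}$, and $\pi_{l-1}\equiv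 \pi_l^p\ [p\pi_l]$ for all $l\ge1$. Artin-Hasse exponential: $E(X)=\exp(AH(X))\in 1+X\mathbb{Z}_p[[X]]$. Put $\theta_l(X)=E(\pi_lX)$ and $\zeta_{p^l}=\theta_l(1)$, which is a primitive $p^l$-th root of unity. $K_m=\mathbb{Q}_p(\zeta_{p^m-1})\subset\mathbb{C}_p$ is the unramified extension of degree $m$ of $\mathbb{Q}_p$, with ring of integers $\mathcal{O}_m^{(u)}$; $\mathcal{T}_m^*$ is the group of $(p^m-1)$-th roots of unity in $\mathcal{O}_m^{(u)}$, and $\mathcal{T}_m=\mathcal{T}_m^*\cup\{0\}$. $\Omega_l=\mathbb{Q}_p(\zeta_{p^l})$; $K_{l,m}$ is the compositum of $\Omega_l$ and $K_m$, and $\mathcal{O}_{l,m}$ its ring of integers; $\pi_l$ lies in $\Omega_l$ and generates the maximal ideal of $\mathcal{O}_{l,m}$. $\tilde\psi_l$ is the additive character of $\mathbb{Z}_p$ of order $p^l$ (hence trivial on $p^l\mathbb{Z}_p$) sending $1$ to $\zeta_{p^l}$, and $\tilde\psi_{l,m}=\tilde\psi_l\circ\mathrm{Tr}_{K_m/\mathbb{Q}_p}$ on $\mathcal{O}_m^{(u)}$. Let $\zeta$ be a generator of $\mathcal{T}_m^*$, and let $\chi$ be the multiplicative character of $\mathcal{O}_m^{(u)*}$ of order $p^m-1$, with values in $\mathbb{C}_p^*$, sending $\zeta$ to $\zeta$ (so $\chi(x)=x$ for $x\in\mathcal{T}_m^*$). *)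

(* Defs.v *)
From HB Require Import structures.
From mathcomp Require Import all_boot all_order all_algebra.
From mathcomp Require Import all_classical all_reals all_analysis.

Set Implicit Arguments.
Unset Strict Implicit.
Unset Printing Implicit Defensive.

Import Order.TTheory GRing.Theory Num.Theory.

Local Open Scope classical_set_scope.
Local Open Scope ring_scope.

Section Subfields.
Variable C : fieldType.
Implicit Types F K S U : set C.

(* Subfields of C are sets, so that extensions inside C are compared by
   inclusion; [adjoin F S] is F(S). *)
Definition is_subfield F : Prop := GRing.divring_closed (mem F).

Definition adjoin F S : set C := smallest is_subfield (F `|` S).

Definition compositum F K : set C := smallest is_subfield (F `|` K).

(* The elements of C that are algebraic over F. *)
Definition alg_over F : set C :=
  [set x | exists q : {poly C},
     [/\ q != 0, q \is a polyOver (mem F) & root q x]].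

Definition alg_closed F : Prop :=
  forall q : {poly C}, q \is a polyOver (mem F) -> (1 < size q)%N ->
    exists2 x, F x & root q x.

(* The entries of the column e form a basis of K as an F-vector space. *)
Definition is_basis F K n (e : 'cV[C]_n) : Prop :=
  (forall i, K (e i 0)) /\
  (forall y, K y -> exists! c : 'rV[C]_n,
     c \is a mxOver (mem F) /\ y = (c *m e) 0 0).

(* Tr_{K/F}(x): the trace of multiplication by x, written in an F-basis of K.
   It does not depend on the basis; the value is 0 by convention when K/F has
   no finite basis or x is not in K. *)
Definition is_trace F K (x t : C) : Prop :=
  exists n (e : 'cV[C]_n) (A : 'M[C]_n),
    [/\ is_basis F K e, A \is a mxOver (mem F), x *: e = A *m e & t = \tr A].

Definition field_trace F K (x : C) : C := xget 0 [set t | is_trace F K x t].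

(* Characters of a subset of C (an additive or a multiplicative group), with
   values in C^*; they are total functions whose values outside the group are
   irrelevant. *)
Definition add_character U (f : C -> C) : Prop :=
  (forall x, U x -> f x != 0) /\
  (forall x y, U x -> U y -> f (x + y) = f x * f y).

Definition mul_character U (f : C -> C) : Prop :=
  (forall x, U x -> f x != 0) /\
  (forall x y, U x -> U y -> f (x * y) = f x * f y).

Definition character_order U (f : C -> C) (n : nat) : Prop :=
  (0 < n)%N /\
  forall k : nat, (forall x, U x -> f x ^+ k = 1) <-> (n %| k)%N.

Definition gauss_sum U (chi psi : C -> C) : C :=
  \sum_(x \in U) chi x * psi x.

(* Congruence x = y modulo the principal ideal zO of the subring O of C. *)
Definition congr_mod (O : set C) (z x y : C) : Prop :=
  [/\ O x, O y & exists2 w, O w & x - y = z * w].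

End Subfields.

Section Valued.
Variables (R : realType) (C : fieldType) (v : C -> \bar R).

Definition val_cvg (u : nat -> C) (l : C) : Prop :=
  v (u n - l) @[n --> \oo] --> +oo%E.

Definition val_cauchy (u : nat -> C) : Prop :=
  v (u n.1 - u n.2) @[n --> (\oo, \oo)] --> +oo%E.

Definition val_closure (A : set C) : set C :=
  [set x | forall M : R, exists2 y, A y & (M%:E <= v (x - y))%E].

(* Q_p inside C_p is the closure of the prime field Q. *)
Definition Qp : set C := val_closure (range (ratr : rat -> C)).

(* (C, v) is the completion of an algebraic closure of Q_p, with v(p) = 1.
   These conditions determine (C, v) up to isomorphism: v restricts to the
   p-adic valuation of Q, [Qp] is complete since it is closed, and
   [alg_over Qp] is an algebraic closure of [Qp], dense in the complete
   field C. *)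
Record is_Cp (p : nat) : Prop := {
  Cp_val0 : v 0 = +oo%E;
  Cp_val_fin : forall x, x != 0 -> v x \is a fin_num;
  Cp_valM : forall x y, v (x * y) = (v x + v y)%E;
  Cp_valD : forall x y, (Order.min (v x) (v y) <= v (x + y))%E;
  Cp_valp : v p%:R = 1%E;
  Cp_complete : forall u, val_cauchy u -> exists l, val_cvg u l;
  Cp_alg_closed : alg_closed (alg_over Qp);
  Cp_dense : val_closure (alg_over Qp) = setT
}.

(* x = y [z] *)
Definition val_cong (x y z : C) : Prop := (v z <= v (x - y))%E.

Definition integers (K : set C) : set C := [set x | K x /\ (0 <= v x)%E].

Definition units (K : set C) : set C := [set x | K x /\ v x = 0%E].

(* A formal power series over Q is the function giving its coefficients. *)
Definition series_at (f : nat -> rat) (x l : C) : Prop :=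
  val_cvg (fun n => \sum_(i < n) ratr (f i) * x ^+ i) l.

(* The sum of a convergent series; 0 by convention otherwise. *)
Definition series_eval (f : nat -> rat) (x : C) : C :=
  xget 0 [set l | series_at f x l].

End Valued.

(* Since i < p ^ i for p > 1, only the i <= n contribute to the coefficient
   of X^n in the sum of the X^(p^i) / p^i. *)
Definition AH (p n : nat) : rat :=
  \sum_(i < n.+1 | (p ^ i == n)%N) ((p ^ i)%:R)^-1.

(* exp(f) = sum_k f^k / k! for a series f without constant term: then the
   coefficient of X^n only involves the k <= n and f modulo X^(n+1). *)
Definition series_exp (f : nat -> rat) (n : nat) : rat :=
  \sum_(k < n.+1) ((\poly_(i < n.+1) f i) ^+ k)`_n / (k`!)%:R.

Definition AHexp (p : nat) : nat -> rat := series_exp (AH p).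

Section ArtinHasse.
Variables (R : realType) (p : nat) (C : fieldType) (v : C -> \bar R).

(* A root of AH must be a point at which the series converges, hence the
   relation [series_at] and not the total function [series_eval]. *)
Definition compatible_roots (pi_ : nat -> C) : Prop :=
  pi_ 0%N = 0 /\
  forall l, (1 <= l)%N ->
    [/\ series_at v (AH p) (pi_ l) 0,
        v (pi_ l) = (((p ^ l - p ^ l.-1)%N%:R)^-1)%:E
      & val_cong v (pi_ l.-1) (pi_ l ^+ p) (p%:R * pi_ l)].

Definition theta (pi_ : nat -> C) (l : nat) (x : C) : C :=
  series_eval v (AHexp p) (pi_ l * x).

Definition zeta_p (pi_ : nat -> C) (l : nat) : C := theta pi_ l 1.

(* Q_p(w), where w is to be a primitive (p^m - 1)-th root of unity. *)
Definition Kunr (w : C) : set C := adjoin (Qp v) [set w].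

Definition Omega (pi_ : nat -> C) (l : nat) : set C :=
  adjoin (Qp v) [set zeta_p pi_ l].

Definition Klm (pi_ : nat -> C) (l : nat) (w : C) : set C :=
  compositum (Omega pi_ l) (Kunr w).

(* The group T_m^* of roots of unity in the ring of integers of K_m. *)
Definition Tstar (m : nat) (w : C) : set C :=
  [set x | integers v (Kunr w) x /\ x ^+ (p ^ m - 1) = 1].

End ArtinHasse.

(* Main.v *)
Require Import Defs.
From HB Require Import structures.
From mathcomp Require Import all_boot all_order all_algebra.
From mathcomp Require Import all_classical all_reals all_analysis.
From mathcomp Require Import ring lra zify.

(** The values of the additive character on Teichmueller representatives are
given by a product of power series. Write E(X) = exp(AH(X)) for the
Artin-Hasse exponential and let y be a root of unity with y^(p^m) = y and
trace t = y + y^p + ... + y^(p^(m-1)). Only powers X^(p^i) occur in AH, and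
replacing y by y^(p^i) permutes the terms of t; so the formal identity
AH(yX) + AH(y^p X) + ... + AH(y^(p^(m-1)) X) = t AH(X) holds, and
exponentiating it ([AHe_prod_trace]) gives E(yX) ... E(y^(p^(m-1)) X) = E(X)^t.
The coefficients of E are p-integral ([AHexp_integral], Dwork's lemma), so both
sides can be evaluated at pi_l, of positive valuation, and the right-hand side
becomes zeta^t, that is psi(t) ([dwork_splitting], [add_char_approx]).

Substituting this in the Gauss sum and expanding, one gets a combination of
monomials pi_l^(k_0 + ... + k_(m-1)) times sums over the roots of unity of
y^(k_0 + p k_1 + ... + p^(m-1) k_(m-1) - a). Such a sum vanishes unless the
exponent is divisible by p^m - 1, and then it is p^m - 1. Among the (k_i) with
this property the digits of a are the only ones whose sum is at most s(a)
([digit_sum_min]: a digit that is at least p can be carried, which lowers the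
sum). As the k-th coefficient of E is 1/k! for k < p, the leading term is
(p^m - 1) pi_l^s(a) / p(a), which is - pi_l^s(a) / p(a) modulo pi_l^(s(a)+1)
([gauss_expand]).

Two facts on the fields involved have to be established besides.

The trace from K_m to Q_p of a root of unity y is y + y^p + ... ([field_trace_wpow]).
The point is that the product g of the X - w^(p^j), j < m, where w generates the
roots of unity, has coefficients in Q_p. Modulo the maximal ideal these
coefficients are fixed by Frobenius, hence integers ([orbit_poly_mod_p]); this
yields an integral polynomial eps whose values at the roots of unity are, modulo
the maximal ideal, the indicator of the conjugates of w ([orbit_indicator]). The
powers eps^(p^k) converge to that indicator, so that a sum over the conjugates of
w is a limit of sums over all roots of unity, which lie in Q_p
([orbit_sum_Q]). Conversely, a relation over Q_p satisfied by w is, once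
normalized, satisfied modulo the maximal ideal by its m conjugates, so that it has
degree at least m ([w_independent]). The powers w^i, i < m, thus form a basis of
K_m, in which multiplication by y is diagonalized by the Vandermonde matrix of the
conjugates of w.

The root pi_l lies in Q_p(zeta) ([AHexp_inverse_field]): inverting the integral
power series E(X) - 1 = X + ... approximates pi_l by integral polynomials in
zeta - 1, and the Z_p-span of the powers of zeta - 1 is closed because zeta - 1 is
a uniformizer which is integral of degree p^l - p^(l-1) ([eisenstein_limit]). *)

Set Implicit Arguments.
Unset Strict Implicit.
Unset Printing Implicit Defensive.

Import Order.TTheory GRing.Theory Num.Theory.

Local Open Scope classical_set_scope.
Local Open Scope ring_scope.

(** * Power series modulo X^N and the truncated exponential *)

(** The error term of the freshman's dream is kept explicit, so as to lie visibly
in every subring containing [x] and [y]. *)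
Lemma expr_prime_add (A : comNzRingType) p (x y : A) : prime p ->
  (x + y) ^+ p = x ^+ p + y ^+ p +
    (\sum_(i < p.-1) (x ^+ (p - i.+1) * y ^+ i.+1) *+ ('C(p, i.+1) %/ p)) *+ p.
Proof.
move=> pr_p; have := prime_gt0 pr_p.
case: p pr_p => // p' pr_p _; set p := p'.+1 in pr_p *.
rewrite exprDn big_ord_recl big_ord_recr /= subn0 expr0 mulr1 bin0 mulr1n.
rewrite subnn expr0 mul1r binn mulr1n -[RHS]addrA.
congr (_ + _); rewrite [RHS]addrC -sumrMnl; congr (_ + _).
apply: eq_bigr => i _; rewrite -mulrnA divnK //.
by apply: prime_dvd_bin => //; rewrite /bump /= ltnS ltn_ord.
Qed.

Section TruncatedExp.
Variable K : fieldType.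
Implicit Types f g h : {poly K}.

(** Congruence modulo X^N. Power series are handled through polynomials known
modulo a power of X. *)
Definition eqX N f g := forall i, (i < N)%N -> f`_i = g`_i.

Lemma eqX_refl N f : eqX N f f. Proof. by []. Qed.
Lemma eqX_sym N f g : eqX N f g -> eqX N g f.
Proof. by move=> h i iN; rewrite h. Qed.
Lemma eqX_trans N f g h : eqX N f g -> eqX N g h -> eqX N f h.
Proof. by move=> h1 h2 i iN; rewrite h1 // h2. Qed.

Lemma eqXM N f f' g g' : eqX N f f' -> eqX N g g' -> eqX N (f * g) (f' * g').
Proof.
move=> h1 h2 i iN; rewrite !coefM; apply: eq_bigr => j _.
by rewrite h1 ?h2 //; apply: leq_ltn_trans iN; rewrite ?leq_subr // -ltnS.
Qed.

Lemma eqX_exp N f f' n : eqX N f f' -> eqX N (f ^+ n) (f' ^+ n).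
Proof. by move=> h; elim: n => // n IH; rewrite !exprS; apply: eqXM. Qed.

Lemma eqX_prod (I : finType) N (F G : I -> {poly K}) :
  (forall i, eqX N (F i) (G i)) -> eqX N (\prod_i F i) (\prod_i G i).
Proof. by move=> h; elim/big_rec2: _ => // i f g _; apply: eqXM. Qed.

Lemma eqX_dvd N f g : eqX N f g -> f - g = drop_poly N (f - g) * 'X^N.
Proof.
move=> h; apply/polyP => i; rewrite coefMXn coef_drop_poly.
by case: ltnP => iN; rewrite ?subnK // coefB h // subrr.
Qed.

Lemma coef_exp_lt f k n : f`_0 = 0 -> (n < k)%N -> (f ^+ k)`_n = 0.
Proof.
move=> f0; have -> : f = drop_poly 1 f * 'X^1.
  by rewrite -{1}[f](subr0) (@eqX_dvd 1 f 0) ?subr0 // => -[|//] _; rewrite f0 coef0.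
by move=> nk; rewrite exprMn -exprM mul1n coefMXn nk.
Qed.

(** exp(f) modulo X^N, for [f] without constant term. *)
Definition texp N f : {poly K} := \sum_(k < N) (k`!%:R)^-1 *: f ^+ k.

Lemma texp_eqX N f g : eqX N f g -> eqX N (texp N f) (texp N g).
Proof.
move=> h i iN; rewrite !coef_sum; apply: eq_bigr => k _.
by rewrite !coefZ (eqX_exp k h).
Qed.

Lemma texp_comp N f g : texp N f \Po g = texp N (f \Po g).
Proof.
rewrite /texp rmorph_sum; apply: eq_bigr => k _.
by rewrite /= comp_polyZ rmorphXn.
Qed.

Hypothesis char0 : forall n, (0 < n)%N -> n%:R != 0 :> K.

(** The terms f^i g^j with i + j >= N, which the product has in excess, vanish
modulo X^N. *)
Lemma texpD N f g : f`_0 = 0 -> g`_0 = 0 ->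
  eqX N (texp N (f + g)) (texp N f * texp N g).
Proof.
move=> f0 g0 n nN.
pose F i j := ((i`!%:R)^-1 *: f ^+ i) * ((j`!%:R)^-1 *: g ^+ j).
have -> : texp N (f + g) =
    \sum_(0 <= k < N) \sum_(0 <= i < N | (i <= k)%N) F (k - i)%N i.
  rewrite /texp big_mkord; apply: eq_bigr => k _.
  rewrite big_mkord; transitivity (\sum_(i < k.+1) F (k - i)%N i); last first.
    by rewrite (big_ord_widen N (fun i => F (k - i)%N i)).
  rewrite exprDn scaler_sumr; apply: eq_bigr => i _.
  rewrite /F -scalerAl -scalerAr scalerA -scaler_nat scalerA.
  congr (_ *: _); have ik : (i <= k)%N by rewrite -ltnS.
  have := bin_fact ik => /(congr1 (fun n => n%:R : K)); rewrite !natrM => <-.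
  by field; rewrite !char0 ?fact_gt0 // bin_gt0.
rewrite (exchange_big_dep_nat predT) //=.

rewrite /texp big_distrlr /= exchange_big /= !coef_sum big_mkord.
apply: eq_bigr => i _.
rewrite -(big_nat_widenl _ _ _ predT) // -{1}[i : nat]add0n big_addn.
under eq_bigr do rewrite addnK.
rewrite -(big_mkord predT (fun j => F j i))
  [in RHS](@big_cat_nat _ _ _ (N - i)) ?leq_subr //=.
rewrite coefD; suff -> : (\sum_(N - i <= j < N) F j i)`_n = 0 by rewrite addr0.
rewrite coef_sum big_nat big1 // => j /andP[jN _].
rewrite /F -scalerAl -scalerAr !coefZ.
suff -> : (f ^+ j * g ^+ i)`_n = 0 by rewrite !mulr0.
rewrite coefM big1 // => t _; have [tj|jt] := ltnP t j.
  by rewrite coef_exp_lt ?mul0r.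
rewrite [X in _ * X]coef_exp_lt ?mulr0 //.
have := ltn_ord t; have := ltn_ord i; lia.
Qed.

Lemma texp0 N : (0 < N)%N -> texp N 0 = 1.
Proof.
case: N => // N _; rewrite /texp big_ord_recl big1 ?addr0 => [|i _].
  by rewrite expr0 fact0 invr1 scale1r.
by rewrite exprS mul0r scaler0.
Qed.

Lemma texpMn N f n : (0 < N)%N -> f`_0 = 0 -> eqX N (texp N (f *+ n)) (texp N f ^+ n).
Proof.
move=> N0 f0; elim: n => [|n IH]; first by rewrite mulr0n texp0.
rewrite mulrS exprS; apply: (@eqX_trans _ _ (texp N f * texp N (f *+ n))).
  by apply: texpD; rewrite // coefMn f0 mul0rn.
exact: eqXM.
Qed.

Lemma texp_sum (I : eqType) (r : seq I) N (F : I -> {poly K}) : (0 < N)%N ->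
  (forall i, (F i)`_0 = 0) ->
  eqX N (texp N (\sum_(i <- r) F i)) (\prod_(i <- r) texp N (F i)).
Proof.
move=> N0 F0; elim: r => [|i r IH]; first by rewrite !big_nil texp0.
rewrite !big_cons; apply: eqX_trans (texpD _ _) (eqXM (@eqX_refl _ _) IH) => //.
by rewrite coef_sum big1.
Qed.
End TruncatedExp.

(** * Digit sums modulo p^m - 1 *)

Section Digits.
Variables (p : nat) (p1 : (1 < p)%N).

Lemma digits_recl m (d : 'I_m.+1 -> nat) :
  (\sum_(i < m.+1) d i * p ^ i = d ord0 + p * \sum_(i < m) d (lift ord0 i) * p ^ i)%N.
Proof.
rewrite big_ord_recl expn0 muln1 big_distrr; congr (_ + _)%N.
by apply: eq_bigr => i _; rewrite /= /bump add1n expnS mulnCA.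
Qed.

Lemma digits_lt m (d : 'I_m -> nat) : (forall i, d i < p)%N ->
  (\sum_(i < m) d i * p ^ i < p ^ m)%N.
Proof.
elim: m d => [|m IH] d hd; first by rewrite big_ord0 expn0.
rewrite digits_recl expnS; have h1 := hd ord0.
have := IH (fun i => d (lift ord0 i)) (fun i => hd _).
set s := (\sum_(i < m) _)%N; nia.
Qed.

Lemma digits_inj m (d k : 'I_m -> nat) :
  (forall i, d i < p)%N -> (forall i, k i < p)%N ->
  (\sum_(i < m) d i * p ^ i = \sum_(i < m) k i * p ^ i)%N -> d =1 k.
Proof.
elim: m d k => [|m IH] d k hd hk; first by move=> _ [].
rewrite !digits_recl => e.
have e0 : d ord0 = k ord0.
  have := congr1 (modn^~ p) e.
  by rewrite /= ![(p * _)%N]mulnC ![(_ ord0 + _)%N]addnC !modnMDl !modn_small.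
have := IH (fun i => d (lift ord0 i)) (fun i => k (lift ord0 i)) (fun i => hd _) (fun i => hk _).
move: e; rewrite e0 => /addnI/eqP; rewrite eqn_pmul2l ?(ltnW p1) // => /eqP e /(_ e) h i.
by case: (unliftP ord0 i) => [j ->|->] //; exact: h.
Qed.

(** Carrying p units of a digit over to the next one, cyclically, preserves the
residue modulo p^m - 1 and lowers the digit sum by p - 1. So a minimal digit
sum is reached by digits below p. The residue determines these, except that 0 and
p^m - 1 are congruent, and the digit sum of 0 is the smaller one. *)
Lemma digit_sum_min m (d k : 'I_m -> nat) : (forall i, d i < p)%N ->
  (\sum_(i < m) d i * p ^ i < p ^ m - 1)%N ->
  (\sum_(i < m) k i * p ^ i = \sum_(i < m) d i * p ^ i %[mod p ^ m - 1])%N ->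
  (\sum_(i < m) k i <= \sum_(i < m) d i)%N -> k =1 d.
Proof.
move=> hd dn; set a := (\sum_(i < m) d i * p ^ i)%N in dn *.
move: {2}(\sum_i k i)%N (leqnn (\sum_i k i)) => s.
elim/ltn_ind: s k => s IH k ks kmod kd.
have [[j pj]|hk] := pselect (exists j, (p <= k j)%N); last first.
  have {}hk i : (k i < p)%N by rewrite ltnNge; apply/negP => h; apply: hk; exists i.
  have kl := digits_lt hk; move: kmod; set b := (\sum_(i < m) k i * p ^ i)%N in kl * => kmod.
  have [bn|bn] := ltnP b (p ^ m - 1).
    by apply: digits_inj => //; move: kmod; rewrite !modn_small.
  have bE : b = (p ^ m - 1)%N by lia.
  move: kmod; rewrite bE modnn modn_small // => /esym a0.
  have d0 i : d i = 0%N.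
    move/eqP: a0; rewrite sum_nat_eq0 => /forallP /(_ i) /=.
    by rewrite muln_eq0 expn_eq0 => /orP[/eqP //|/andP[/eqP p0]]; lia.
  move: kd; rewrite [X in (_ <= X)%N]big1 // leqn0 sum_nat_eq0 => /forallP k0 i.
  by rewrite d0; apply/eqP; exact: (k0 i).
have m0 : (0 < m)%N by apply: leq_ltn_trans (ltn_ord j).
pose jS := Ordinal (ltn_pmod j.+1 m0).
(* [jS] is the successor of [j] modulo m; it is [j] itself when m = 1. *)
pose k' i := (k i - (i == j) * p + (i == jS))%N.
have sum_delta (F : 'I_m -> nat) (c : 'I_m) : (\sum_i (i == c) * F i = F c)%N.
  by rewrite (bigD1 c) //= eqxx mul1n big1 ?addn0 // => i /negPf ->.
have weight (F : 'I_m -> nat) : (\sum_i k' i * F i + p * F j = \sum_i k i * F i + F jS)%N.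
  rewrite -(sum_delta F jS) -(sum_delta (fun i => p * F i)%N j) -!big_split /=.
  apply: eq_bigr => i _; rewrite /k'; case: (i =P j) => [->|_] /=.
    rewrite -[X in (_ = X * _ + _)%N](subnK pj) !mul1n; set t := (k j - p)%N.
    by rewrite !mulnDl addnAC.
  by rewrite !mul0n subn0 addn0 mulnDl.
have sk : (\sum_i k' i + p = \sum_i k i + 1)%N.
  have := weight (fun=> 1%N); rewrite muln1.
  by under eq_bigr do rewrite muln1; under [in RHS]eq_bigr do rewrite muln1.
have pjS : (p * p ^ j = p ^ jS %[mod p ^ m - 1])%N.
  rewrite -expnS /=; have := ltn_ord j; rewrite leq_eqVlt => /orP[/eqP jm|jm].
    rewrite jm modnn expn0 -[X in (X = _ %[mod _])%N](@subnK 1) ?expn_gt0 ?(ltnW p1) //.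
    by rewrite modnDl.
  by rewrite [(j.+1 %% m)%N]modn_small.
have k'mod : (\sum_i k' i * p ^ i = a %[mod p ^ m - 1])%N.
  rewrite -kmod; apply/eqP; rewrite -(eqn_modDr (p * p ^ j)) weight.
  by rewrite eqn_modDl; apply/eqP/esym.
have sk_lt : (\sum_i k' i < \sum_i k i)%N by rewrite -(ltn_add2r p) sk ltn_add2l.
have k'd : k' =1 d.
  apply: (IH (\sum_i k' i)%N); [exact: leq_trans ks | exact: leqnn | exact: k'mod |].
  exact: leq_trans (ltnW sk_lt) kd.
have e : (\sum_i k' i = \sum_i d i)%N by apply: eq_bigr => i _; exact: k'd.
by move: sk_lt; rewrite e ltnNge kd.
Qed.
End Digits.

(** * The Artin-Hasse exponential as a formal power series *)

Section ArtinHasseFormal.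
Variables (p : nat) (hp : prime p).

Lemma AH_pow i : AH p (p ^ i) = ((p ^ i)%:R)^-1.
Proof.
rewrite /AH; have ip : (i < (p ^ i).+1)%N by rewrite ltnS ltnW // ltn_expl ?prime_gt1.
rewrite (bigD1 (Ordinal ip)) //= big1 ?addr0 // => j /andP[/eqP e ne].
by case/eqP: ne; apply/val_inj/(expnI (prime_gt1 hp)).
Qed.

Lemma AH_npow n : (forall i, n != (p ^ i)%N) -> AH p n = 0.
Proof. by move=> h; rewrite /AH big_pred0 // => i; rewrite eq_sym (negPf (h i)). Qed.

Lemma AH0 : AH p 0 = 0.
Proof. by apply: AH_npow => i; rewrite eq_sym -lt0n expn_gt0 prime_gt0. Qed.

Definition AHpoly N : {poly rat} := \poly_(i < N) AH p i.
Definition AHexp_poly N : {poly rat} := \poly_(i < N) AHexp p i.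

Lemma AHpoly_coef0 N : (AHpoly N)`_0 = 0.
Proof. by rewrite coef_poly AH0 if_same. Qed.

Lemma AHexp_polyE N : eqX N (AHexp_poly N) (texp N (AHpoly N)).
Proof.
move=> n nN; rewrite coef_poly nN /AHexp /series_exp coef_sum.
rewrite (big_ord_widen N (fun k => ((\poly_(i < n.+1) AH p i) ^+ k)`_n / k`!%:R)) //.
rewrite big_mkcond; apply: eq_bigr => k _; rewrite coefZ mulrC.
case: ifP => [kn|/negbT]; last first.
  by rewrite -leqNgt => nk; rewrite coef_exp_lt ?AHpoly_coef0 ?mulr0.
congr (_ * _); apply: (@eqX_exp _ n.+1) => // i iN.
by rewrite !coef_poly iN (leq_trans iN nN).
Qed.

Lemma eqX_compXn (K : fieldType) N (f g : {poly K}) d : (0 < d)%N ->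
  eqX N f g -> eqX N (f \Po 'X^d) (g \Po 'X^d).
Proof.
move=> d0 h i iN; rewrite !coef_comp_poly_Xn //; case: ifP => // _.
by apply: h; apply: leq_ltn_trans iN; apply: leq_div.
Qed.

(** p AH(X) = AH(X^p) + p X, since p X^(p^(i+1)) / p^(i+1) = (X^p)^(p^i) / p^i. *)
Lemma AH_feq N : eqX N (AHpoly N *+ p) (AHpoly N \Po 'X^p + p%:R *: 'X).
Proof.
have p0 := prime_gt0 hp.
move=> n nN; rewrite coefMn coefD coef_comp_poly_Xn // coefZ coefX !coef_poly nN.
have -> : (n %/ p < N)%N by apply: leq_ltn_trans nN; apply: leq_div.
have [[i ->]|h] := pselect (exists i, n = p ^ i)%N.
  rewrite AH_pow; case: i => [|i].
    rewrite expn0 invr1 dvdn1 gtn_eqF ?prime_gt1 //= add0r mulr1 //.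
  have -> : (p ^ i.+1 == 1)%N = false by rewrite -(expn0 p) eqn_exp2l ?prime_gt1.
  rewrite mulr0 addr0 expnS dvdn_mulr // mulKn // AH_pow -[LHS]mulr_natl natrM invfM.
  by rewrite mulrA divff ?mul1r // pnatr_eq0 -lt0n.
rewrite AH_npow ?mul0rn => [|i]; last by apply/eqP => e; apply: h; exists i.
case: eqP => [e|_]; first by case: h; exists 0%N; rewrite e expn0.
rewrite mulr0 addr0; case: ifP => // /dvdnP[j e].
rewrite e mulnK // AH_npow // => i; apply/eqP => e2; apply: h.
by exists i.+1; rewrite e e2 expnSr.
Qed.

Lemma char0_rat n : (0 < n)%N -> n%:R != 0 :> rat.
Proof. by rewrite pnatr_eq0 -lt0n. Qed.

(** Obtained by exponentiating p AH(X) = AH(X^p) + p X. *)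
Lemma AHexp_feq N : (0 < N)%N ->
  eqX N (AHexp_poly N ^+ p) ((AHexp_poly N \Po 'X^p) * texp N (p%:R *: 'X)).
Proof.
move=> N0; have p0 := prime_gt0 hp.
apply: eqX_trans (eqX_exp p (@AHexp_polyE N)) _.
apply: eqX_trans (eqX_sym (texpMn char0_rat p N0 (AHpoly_coef0 N))) _.
apply: eqX_trans (texp_eqX (@AH_feq N)) _.
apply: eqX_trans (texpD char0_rat _ _) _.
- by rewrite coef_comp_poly_Xn // dvdn0 div0n AHpoly_coef0.
- by rewrite coefZ coefX mulr0.
rewrite -texp_comp; apply: eqXM => //.
by apply: eqX_compXn => //; apply/eqX_sym/AHexp_polyE.
Qed.

Lemma AHexp_small k : (k < p)%N -> AHexp p k = (k`!%:R)^-1.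
Proof.
move=> kp; rewrite /AHexp /series_exp.
have -> : \poly_(i < k.+1) AH p i = (if (0 < k)%N then 'X else 0) :> {poly rat}.
  apply/polyP => i; rewrite coef_poly.
  have AHi : (i <= k)%N -> AH p i = (i == 1%N)%:R.
    move=> ik; case: eqP => [->|i1]; first by have := AH_pow 0; rewrite expn0 invr1.
    apply: AH_npow => j; apply/eqP => e; case: j e => [//|j e]; move: (leq_ltn_trans ik kp).
    by rewrite e expnS ltnNge leq_pmulr ?expn_gt0 ?prime_gt0.
  rewrite ltnS; case: ifP => [ik|/negbT]; last rewrite -ltnNge => ki.
    rewrite AHi //; case: ifP => k0; first by rewrite coefX.
    by move/negbT: k0 ik; rewrite -eqn0Ngt coef0 => /eqP ->; case: i {AHi}.
  case: ifP => k0; last by rewrite coef0.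
  by rewrite coefX gtn_eqF // (leq_trans _ ki).
rewrite big_ord_recr big1 ?add0r /= => [|i _].
  by case: k {kp} => [|k]; rewrite ?expr0 ?coef1 ?coefXn ?eqxx ?mul1r //= ?add0r.
case: ifP => k0; first by rewrite coefXn gtn_eqF ?mul0r.
by move/negbT: k0; rewrite -eqn0Ngt => /eqP k0; case: i => i /=; rewrite k0.
Qed.
End ArtinHasseFormal.

(** * The valuation ring of C_p *)

Section Preds.
Variables (R : realType) (p : nat) (C : fieldType) (v : C -> \bar R).

(** The proof that (C, v) is C_p is a parameter of the three predicates below, so
that their closure properties can be declared as canonical instances: the
valuation ring, its maximal ideal, and the fractional ideals v x >= r. *)
Definition vring of is_Cp v p : {pred C} := fun x => (0 <= v x)%E.
Definition vmax of is_Cp v p : {pred C} := fun x => (0 < v x)%E.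
Definition vball of is_Cp v p := fun r : R =>
  (fun x => (r%:E <= v x)%E) : {pred C}.
End Preds.

Section Valuation.
Variables (R : realType) (p : nat) (hp : prime p) (C : fieldType).
Variables (v : C -> \bar R) (hC : is_Cp v p).

Notation O := (vring hC).
Notation B := (vball hC).
Notation M := (vmax hC).

Lemma OE x : (x \in O) = (0 <= v x)%E. Proof. by []. Qed.
Lemma BE r x : (x \in B r) = (r%:E <= v x)%E. Proof. by []. Qed.
Lemma ME x : (x \in M) = (0 < v x)%E. Proof. by []. Qed.
Lemma O_B0 x : (x \in O) = (x \in B 0). Proof. by []. Qed.

Lemma val_fin x : x != 0 -> exists r : R, v x = r%:E.
Proof. by move=> /(Cp_val_fin hC) /fineK <-; eexists. Qed.

Lemma val_one : v 1 = 0%E.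
Proof.
have [r vr] := val_fin (oner_neq0 C).
have := Cp_valM hC 1 1; rewrite mulr1 vr -EFinD => -[] h.
by congr (_%:E); lra.
Qed.

Lemma val_opp x : v (- x) = v x.
Proof.
have vN1 : v (-1) = 0%E.
  have [r vr] : exists r : R, v (-1) = r%:E.
    by apply: val_fin; rewrite oppr_eq0 oner_eq0.
  have := Cp_valM hC (-1) (-1); rewrite mulrNN mulr1 val_one vr -EFinD => -[] h.
  by congr (_%:E); lra.
by rewrite -mulN1r (Cp_valM hC) vN1 add0e.
Qed.

Lemma val_expn x r n : v x = r%:E -> v (x ^+ n) = (n%:R * r)%:E.
Proof.
move=> vx; elim: n => [|n IH]; first by rewrite expr0 mul0r val_one.
rewrite exprS (Cp_valM hC) IH vx -EFinD; congr (_%:E).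
by rewrite -[in RHS]natr1 mulrDl mul1r addrC.
Qed.

Lemma val_inv x r : x != 0 -> v x = r%:E -> v x^-1 = (- r)%:E.
Proof.
move=> x0 vx; have [s vs] : exists s : R, v x^-1 = s%:E.
  by apply: val_fin; rewrite invr_eq0.
have := Cp_valM hC x x^-1; rewrite divff // val_one vx vs -EFinD => -[] h.
by congr (_%:E); lra.
Qed.

Lemma val_neq0 x r : v x = r%:E -> x != 0.
Proof. by apply: contra_eq_neq => ->; rewrite (Cp_val0 hC). Qed.

Lemma vball0 r : 0 \in B r.
Proof. by rewrite BE (Cp_val0 hC) leey. Qed.

Lemma vball_zmod r : zmod_closed (B r).
Proof.
split=> [|x y]; rewrite ?vball0 // !BE => hx hy.
by apply: le_trans (Cp_valD hC _ _); rewrite val_opp le_min hx.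
Qed.
HB.instance Definition _ r := GRing.isZmodClosed.Build C (B r) (vball_zmod r).

Lemma max_zmod : zmod_closed M.
Proof.
split=> [|x y]; rewrite !ME ?(Cp_val0 hC) // => hx hy.
by apply: lt_le_trans (Cp_valD hC _ _); rewrite val_opp lt_min hx.
Qed.
HB.instance Definition _ := GRing.isZmodClosed.Build C M max_zmod.

Lemma vballM r s x y : x \in B r -> y \in B s -> x * y \in B (r + s).
Proof. by rewrite !BE (Cp_valM hC) EFinD; apply: leeD. Qed.

Lemma ring_subring : subring_closed O.
Proof.
split=> [|x y|x y]; rewrite ?OE ?val_one //.
  by rewrite -![(0 <= v _)%E]BE; apply: rpredB.
by move=> hx hy; rewrite (Cp_valM hC) adde_ge0.
Qed.
HB.instance Definition _ := GRing.isSubringClosed.Build C O ring_subring.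

Lemma vballMl r x y : x \in O -> y \in B r -> x * y \in B r.
Proof. by move=> hx hy; rewrite -[r]add0r vballM. Qed.

Lemma vballMr r x y : x \in B r -> y \in O -> x * y \in B r.
Proof. by move=> hx hy; rewrite mulrC vballMl. Qed.

Lemma maxMl x y : x \in O -> y \in M -> x * y \in M.
Proof.
rewrite !ME OE (Cp_valM hC) => hx hy; exact: lt_le_trans hy (leeDr _ hx).
Qed.

Lemma maxMr x y : x \in M -> y \in O -> x * y \in M.
Proof. by move=> hx hy; rewrite mulrC maxMl. Qed.

Lemma max_sub : {subset M <= O}.
Proof. by move=> x; rewrite ME OE => /ltW. Qed.

Lemma vball_le r s x : r <= s -> x \in B s -> x \in B r.
Proof. by rewrite !BE => rs; apply: le_trans; rewrite lee_fin. Qed.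

Lemma vball_max r x : 0 < r -> x \in B r -> x \in M.
Proof. by rewrite ME BE => r0; apply: lt_le_trans; rewrite lte_fin. Qed.

Lemma vball_ring r x : 0 <= r -> x \in B r -> x \in O.
Proof. by move=> r0; rewrite O_B0; apply: vball_le. Qed.

Lemma max1 : 1 \notin M. Proof. by rewrite ME val_one ltxx. Qed.

Lemma vballX r x n : x \in B r -> x ^+ n \in B (n%:R * r).
Proof.
move=> hx; elim: n => [|n IH]; first by rewrite expr0 mul0r -O_B0 rpred1.
by rewrite exprS -natr1 mulrDl mul1r addrC vballM.
Qed.


Lemma pB1 : (p%:R : C) \in B 1.
Proof. by rewrite BE (Cp_valp hC). Qed.

Lemma p_max : (p%:R : C) \in M.
Proof. by rewrite ME (Cp_valp hC) lte_fin. Qed.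

Lemma natr_ring n : n%:R \in O.
Proof. exact: rpred_nat. Qed.

Lemma ppow_ball k : (p%:R ^+ k : C) \in B k%:R.
Proof. by rewrite -[k%:R]mulr1 vballX // pB1. Qed.

Lemma val_unit x : x \in O -> x \notin M -> v x = 0%E.
Proof.
rewrite OE ME -leNgt => h1 h2; apply/eqP; rewrite eq_le h1 andbT; exact: h2.
Qed.

(** By Bezout, an integer prime to p in the maximal ideal would force 1 to be in it. *)
Lemma natr_unit n : coprime p n -> v n%:R = 0%E.
Proof.
move=> cop; apply: val_unit (natr_ring n) _; apply/negP => nM.
have n_gt0 : (0 < n)%N.
  by case: n cop {nM} => //; rewrite /coprime gcdn0 => /eqP p1; move: hp; rewrite p1.
have [u w e _] := egcdnP p n_gt0.
have : ((u * n)%N%:R - (w * p)%N%:R : C) \in M.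
  by rewrite rpredB // natrM maxMl ?natr_ring ?p_max.
rewrite e gcdnC (eqP cop) natrD addrAC subrr add0r.
exact/negP/max1.
Qed.

Lemma natC_neq0 n : (0 < n)%N -> n%:R != 0 :> C.
Proof.
move=> n0; have [n' cop ->] := pfactor_coprime hp n0.
rewrite natrM natrX mulf_neq0 ?expf_neq0 //.
  by rewrite (@val_neq0 _ 0) // natr_unit.
by rewrite (@val_neq0 _ 1) // (Cp_valp hC).
Qed.

Lemma natC_eq0 n : (n%:R == 0 :> C) = (n == 0%N).
Proof. by case: n => [|n]; rewrite ?eqxx // (negPf (natC_neq0 _)). Qed.

Lemma intC_eq0 (z : int) : (z%:~R == 0 :> C) = (z == 0).
Proof.
case: z => n; first by rewrite natC_eq0.
by rewrite NegzE mulrNz oppr_eq0 natC_eq0.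
Qed.

Lemma intr_ring (z : int) : z%:~R \in O.
Proof. exact: rpred_int. Qed.

Lemma natr_in_max n : (n%:R \in M) = (p %| n)%N.
Proof.
apply/idP/idP => [nM|/dvdnP[k ->]]; last by rewrite natrM maxMl ?natr_ring ?p_max.
apply: contraT; rewrite -prime_coprime // => /natr_unit h.
by move: nM; rewrite ME h ltxx.
Qed.

Lemma intr_in_max (z : int) : (z%:~R \in M) = (p%:Z %| z)%Z.
Proof.
rewrite dvdzE absz_nat -natr_in_max.
by case: z => n //; rewrite NegzE mulrNz abszN absz_nat rpredN.
Qed.

Lemma intr_ppow (z : int) k : (p%:Z ^+ k %| z)%Z -> z%:~R \in B k%:R.
Proof.
by case/dvdzP=> y ->; rewrite rmorphM rmorphXn /= vballMl ?intr_ring ?ppow_ball.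
Qed.

(** The value of [ratr] on an arbitrary fraction, reduced or not, from which it is a
ring morphism into C_p although C_p is not an ordered field. *)
Lemma ratr_div (a b : int) : b != 0 -> ratr (a%:Q / b%:Q) = a%:~R / b%:~R :> C.
Proof.
move=> b0; set q := _ / _; rewrite /ratr.
have : (numq q * b = a * denq q).
  apply/eqP; rewrite -(eqr_int rat) !rmorphM /= numqE mulrAC /q.
  by rewrite mulfVK // intq_eq0.
move/(congr1 (intr : int -> C)); rewrite !rmorphM /= => e.
have b0' : (b%:~R : C) != 0 by rewrite intC_eq0.
have d0' : ((denq q)%:~R : C) != 0 by rewrite intC_eq0 denq_eq0.
by apply: (mulIf b0'); rewrite mulfVK // mulrAC e mulfK.
Qed.

Lemma ratr_additive : zmod_morphism (@ratr C).
Proof.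
move=> x y; rewrite -[x]divq_num_den -[y]divq_num_den.
set a := numq x; set b := denq x; set c := numq y; set d := denq y.
have b0 : b != 0 by rewrite denq_eq0. have d0 : d != 0 by rewrite denq_eq0.
have -> : a%:Q / b%:Q - c%:Q / d%:Q = (a * d - c * b)%:~R / (b * d)%:~R.
  rewrite rmorphB !rmorphM /=; field.
  by rewrite !intq_eq0 b0 d0.
rewrite !ratr_div ?mulf_neq0 // rmorphB !rmorphM /=; field.
by rewrite !intC_eq0 b0 d0.
Qed.

Lemma ratr_multiplicative : monoid_morphism (@ratr C).
Proof.
split=> [|x y]; first by rewrite -[1]/(1%:Q / 1%:Q) ratr_div // divr1.
rewrite -[x]divq_num_den -[y]divq_num_den.
set a := numq x; set b := denq x; set c := numq y; set d := denq y.
have b0 : b != 0 by rewrite denq_eq0. have d0 : d != 0 by rewrite denq_eq0.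
have -> : (a%:Q / b%:Q) * (c%:Q / d%:Q) = (a * c)%:~R / (b * d)%:~R.
  rewrite !rmorphM /=; field.
  by rewrite !intq_eq0 b0 d0.
rewrite !ratr_div ?mulf_neq0 // !rmorphM /=; field.
by rewrite !intC_eq0 b0 d0.
Qed.
End Valuation.


Section RatMorphism.
Variables (R : realType) (p : nat) (hp : prime p) (C : fieldType).
Variables (v : C -> \bar R) (hC : is_Cp v p).

(** An alias of [ratr] that carries its structure of ring morphism into C_p. *)
Definition ratC of prime p & is_Cp v p : rat -> C := ratr.
HB.instance Definition _ :=
  GRing.isZmodMorphism.Build rat C (ratC hp hC) (ratr_additive hp hC).
HB.instance Definition _ :=
  GRing.isMonoidMorphism.Build rat C (ratC hp hC) (ratr_multiplicative hp hC).
End RatMorphism.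

(** * The field Q_p *)

Section QpTheory.
Variables (R : realType) (p : nat) (hp : prime p) (C : fieldType).
Variables (v : C -> \bar R) (hC : is_Cp v p).
Notation O := (vring hC).
Notation B := (vball hC).
Notation M := (vmax hC).
Notation QpC := (Qp v).

Lemma ratr_Qp (q : rat) : QpC (ratr q).
Proof.
move=> r; exists (ratr q); first by exists q.
by rewrite subrr (Cp_val0 hC) leey.
Qed.

Lemma Qp_closed x : (forall r : R, exists2 y, QpC y & x - y \in B r) -> QpC x.
Proof.
move=> h r; have [y yQ xy] := h r; have [z zQ yz] := yQ r.
exists z => //; change (x - z \in B r).
by have -> : x - z = (x - y) + (y - z); [ring | apply: rpredD].
Qed.

Lemma QpP x r : QpC x -> exists q : rat, x - ratr q \in B r.
Proof. by move=> /(_ r) [y [q _ <-] h]; exists q. Qed.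

Lemma QpB x y : QpC x -> QpC y -> QpC (x - y).
Proof.
move=> hx hy; apply: Qp_closed => r.
have [a ha] := QpP r hx; have [b hb] := QpP r hy.
exists (ratr (a - b)); first exact: ratr_Qp.
rewrite -[ratr _]/(ratC hp hC _) rmorphB /= /ratC.
have -> : x - y - (ratr a - ratr b) = (x - ratr a) - (y - ratr b) by ring.
exact: rpredB.
Qed.

Lemma some_ball x : exists2 r : R, 0 <= r & x \in B (- r).
Proof.
have [->|x0] := eqVneq x 0; first by exists 0 => //; rewrite vball0.
have [r vr] := val_fin hC x0; exists `|r| => //.
by rewrite BE vr lee_fin lerNnormlW // lerNl lerNnormlW.
Qed.

Lemma QpM x y : QpC x -> QpC y -> QpC (x * y).
Proof.
move=> hx hy; apply: Qp_closed => r.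
have [s s0 sx] := some_ball x; have [t t0 ty] := some_ball y.
have [a ha] := QpP (`|r| + t) hx.
have [b hb] := QpP (`|r| + s) hy.
exists (ratr (a * b)); first exact: ratr_Qp.
rewrite -[ratr _]/(ratC hp hC _) rmorphM /= /ratC.
have -> : x * y - ratr a * ratr b =
  (x - ratr a) * y + x * (y - ratr b) - (x - ratr a) * (y - ratr b) by ring.
have rn := ler_norm r; have rp := normr_ge0 r.
rewrite rpredB ?rpredD //.
- by apply: (vball_le _ (vballM ha ty)); lra.
- by apply: (vball_le _ (vballM sx hb)); lra.
- by apply: (vball_le _ (vballM ha hb)); lra.
Qed.


(** The ultrametric inequality applied to y = x - (x - y) and to x = y + (x - y). *)
Lemma val_perturb x y : (v x < v (x - y))%E -> v y = v x.
Proof.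
move=> h; apply/eqP; rewrite eq_le; apply/andP; split.
  have := Cp_valD hC y (x - y); rewrite (_ : y + (x - y) = x); last by ring.
  by rewrite ge_min => /orP[//|]; rewrite leNgt h.
have := Cp_valD hC x (- (x - y)); rewrite (_ : x - (x - y) = y); last by ring.
by apply: le_trans; rewrite (val_opp hC) le_min lexx ltW.
Qed.

Lemma QpV x : QpC x -> QpC x^-1.
Proof.
move=> hx; have [->|x0] := eqVneq x 0.
  by rewrite invr0; have := ratr_Qp 0; rewrite -[ratr _]/(ratC hp hC _) rmorph0.
apply: Qp_closed => r; have [s vs] := val_fin hC x0.
have [a ha] := QpP (`|r| + `|s| + `|s| + 1) hx.
have r1 := ler_norm r; have s1 := ler_norm s; have r2 := normr_ge0 r.
have va : v (ratr a) = s%:E.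
  rewrite -vs; apply: val_perturb; apply: lt_le_trans ha.
  by rewrite vs lte_fin; have := normr_ge0 s; lra.
have a0 := val_neq0 hC va.
exists (ratr a^-1); first exact: ratr_Qp.
rewrite -[ratr _]/(ratC hp hC _) fmorphV /= /ratC.
have -> : x^-1 - (ratr a)^-1 = - ((x - ratr a) * (x^-1 * (ratr a)^-1)).
  by field; rewrite x0 a0.
rewrite rpredN; apply: (@vball_le _ _ _ _ _ _ ((`|r| + `|s| + `|s| + 1) + (- s - s))).
  by lra.
apply: vballM => //; apply: vballM; by rewrite BE (val_inv hC _ vs, val_inv hC _ va).
Qed.

Lemma Qp_natr n : QpC n%:R.
Proof. by have := ratr_Qp n%:R; rewrite -[ratr _]/(ratC hp hC _) rmorph_nat. Qed.

Lemma Qp_subfield : is_subfield QpC.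
Proof.
split; rewrite /in_mem /=.
- exact/mem_set/(Qp_natr 1).
- by move=> x y /set_mem hx /set_mem hy; apply/mem_set/QpB.
- by move=> x y /set_mem hx /set_mem hy; apply/mem_set/QpM => //; apply: QpV.
Qed.

(** An approximating rational number has a denominator prime to p, which can be
inverted modulo p^k. *)
Lemma Zp_approx x k : QpC x -> x \in O -> exists n : nat, x - n%:R \in B k%:R.
Proof.
move=> hx xO; have [q hq] := QpP k%:R hx.
suff [n hn] : exists n : nat, ratr q - n%:R \in B k%:R.
  by exists n; rewrite -(subrK (ratr q) x) -addrA rpredD.
have qO : ratr q \in O.
  have -> : ratr q = x - (x - ratr q) :> C by ring.
  by rewrite rpredB // (vball_ring _ hq) // ler0n.
have bun : coprime p `|denq q|.
  rewrite prime_coprime //; apply/negP => pd.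
  have : (numq q)%:~R \in M.
    have -> : (numq q)%:~R = ratr q * (denq q)%:~R :> C.
      by rewrite /ratr divfK // (intC_eq0 hp hC) // denq_eq0.
    by rewrite maxMl // intr_in_max // dvdzE.
  rewrite intr_in_max // dvdzE absz_nat => pn.
  have := coprime_num_den q; rewrite /coprime => /eqP e.
  have := dvdn_gcd p `|numq q| `|denq q|; rewrite pn pd e dvdn1.
  by move=> /eqP p1; move: hp; rewrite p1.
have d0 : (0 < `|denq q|)%N by rewrite absz_gt0 denq_eq0.
have pk0 : (0 < p ^ k)%N by rewrite expn_gt0 prime_gt0.
have := coprimeXl k bun; set b := `|denq q|%N in bun d0 * => cop.
have [u w e _] := egcdnP (p ^ k) d0.
rewrite gcdnC (eqP cop) in e.
have bE : (denq q)%:~R = b%:R :> C by rewrite -[denq q in LHS]gez0_abs ?denq_ge0.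
have vb : v b%:R = 0%E by apply: (natr_unit hp hC).
have b0 : (b%:R : C) != 0 by apply: (val_neq0 hC vb).
have binv : b%:R^-1 \in O by rewrite OE (val_inv hC b0 vb) oppr0.
pose z := (numq q * u%:Z)%Z; pose n := `|(z %% (p ^ k)%N%:Z)%Z|%N.
exists n.
have nE : (n%:R : C) = z%:~R - (z %/ (p ^ k)%N%:Z)%Z%:~R * p%:R ^+ k.
  have : n%:Z = z - (z %/ (p ^ k)%N%:Z)%Z * (p ^ k)%N%:Z.
    rewrite /n gez0_abs; last by rewrite modz_ge0 // eqz_nat -lt0n.
    by rewrite {2}(divz_eq z (p ^ k)%N%:Z) addrC addKr.
  move/(congr1 (intr : int -> C)); rewrite rmorphB rmorphM /= => e2.
  by rewrite -[LHS]/((n%:Z)%:~R) e2 -natrX [in RHS]rmorphM [in LHS]rmorphM.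
rewrite nE opprB addrA addrAC; apply: rpredD; last first.
  by rewrite vballMl ?intr_ring ?ppow_ball.
have -> : ratr q - z%:~R = - ((numq q)%:~R * b%:R^-1 * w%:R * p%:R ^+ k) :> C.
  rewrite /ratr bE /z rmorphM /= -[u%:~R]/(u%:R).
  have : (u * b)%N%:R = (w * p ^ k + 1)%N%:R :> C by rewrite e.
  rewrite natrD !natrM natrX => e2.
  apply: (mulIf b0); rewrite mulrBl divfK // -[_ * u%:R * _]mulrA e2.
  by field.
rewrite rpredN vballMl ?ppow_ball // rpredM ?natr_ring //.
by rewrite rpredM ?intr_ring.
Qed.
End QpTheory.

(** * Frobenius congruences and the integrality of the Artin-Hasse exponential *)

(** Legendre's formula gives v(k!) <= (k - 1)/(p - 1). *)
Lemma logn_fact_lt p k : prime p -> (0 < k)%N -> (logn p k`! < k)%N.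
Proof.
move=> hp k0; rewrite logn_fact //; have p1 := prime_gt1 hp.
(* The summand with [maxn] makes the bound strict and telescoping: each quotient is
   at most half of the preceding one. *)
suff h n : (\sum_(1 <= i < n.+1) k %/ p ^ i + maxn 1 (k %/ p ^ n) <= k)%N.
  by apply: leq_trans (h k); rewrite -addn1 leq_add2l leq_maxl.
elim: n => [|n IH].
  by rewrite big_geq // expn0 divn1 add0n geq_max k0 leqnn.
apply: leq_trans IH; rewrite big_nat_recr //= -addnA leq_add2l.
rewrite expnSr divnMA; set a := (k %/ p ^ n)%N.
have h1 := leq_trunc_div a p.
case: (posnP (a %/ p)) => [->|ap]; first by rewrite add0n leq_max.
rewrite (maxn_idPr ap) leq_max; apply/orP; right; apply: leq_trans h1.
by rewrite addnn -muln2 leq_mul2l p1 orbT.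
Qed.

Section Integrality.
Variables (R : realType) (p : nat) (hp : prime p) (C : fieldType).
Variables (v : C -> \bar R) (hC : is_Cp v p).
Notation O := (vring hC).
Notation B := (vball hC).
Notation M := (vmax hC).
Notation QpC := (Qp v).
Notation rC := (ratC hp hC).

Lemma polyOver_ballMl r (f g : {poly C}) :
  f \is a polyOver O -> g \is a polyOver (B r) -> f * g \is a polyOver (B r).
Proof.
move=> /polyOverP hf /polyOverP hg; apply/polyOverP => i.
by rewrite coefM rpred_sum // => j _; apply: vballMl.
Qed.

Lemma horner_ball r (f : {poly C}) x :
  f \is a polyOver (B r) -> x \in O -> f.[x] \in B r.
Proof.
move=> /polyOverP hf xO; rewrite horner_coef rpred_sum // => i _.
by rewrite vballMr // rpredX.
Qed.

Lemma horner_max (f : {poly C}) x :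
  f \is a polyOver M -> x \in O -> f.[x] \in M.
Proof.
move=> /polyOverP hf xO; rewrite horner_coef rpred_sum // => i _.
by rewrite maxMr // rpredX.
Qed.

Lemma freshman (f g : {poly C}) :
  f \is a polyOver O -> g \is a polyOver O ->
  (f + g) ^+ p - (f ^+ p + g ^+ p) \is a polyOver (B 1).
Proof.
move=> fO gO; rewrite expr_prime_add // addrAC subrr add0r.
apply/polyOverP => i; rewrite coefMn -mulr_natl vballMr ?pB1 //.
apply/polyOverP: i; apply: rpred_sum => i _.
by rewrite rpredMn // rpredM // rpredX.
Qed.

Lemma freshman_sum n (F : nat -> {poly C}) : (forall i, F i \is a polyOver O) ->
  (\sum_(i < n) F i) ^+ p - \sum_(i < n) F i ^+ p \is a polyOver (B 1).
Proof.
move=> FO; elim: n => [|n IH].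
  by rewrite !big_ord0 expr0n gtn_eqF ?prime_gt0 // subr0 rpred0.
rewrite !big_ord_recr /=; set s := \sum_(i < n) _ in IH *.
set t := \sum_(i < n) _ in IH *.
have -> : (s + F n) ^+ p - (t + F n ^+ p) =
  ((s + F n) ^+ p - (s ^+ p + F n ^+ p)) + (s ^+ p - t) by ring.
by rewrite rpredD // freshman // rpred_sum.
Qed.

(** Elements fixed by Frobenius modulo p, and not only modulo the maximal ideal; those
of Z_p are of this kind. *)
Definition frob_fixed (c : C) := c \in O /\ c ^+ p - c \in B 1.

Lemma natr_frob n : n%:R ^+ p - n%:R \in B 1.
Proof.
elim: n => [|n IH]; first by rewrite expr0n gtn_eqF ?prime_gt0 // subr0 rpred0.
rewrite -natr1 expr_prime_add // expr1n; set z := \sum_(i < _) _.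
have zO : z \in O.
  apply: rpred_sum => i _.
  by rewrite expr1n mulr1 rpredMn // rpredX // rpred_nat.
have -> : n%:R ^+ p + 1 + z *+ p - (n%:R + 1) = (n%:R ^+ p - n%:R) + p%:R * z.
  by rewrite mulr_natl; ring.
by rewrite rpredD // vballMr ?pB1.
Qed.

Lemma Zp_frob c : QpC c -> c \in O -> frob_fixed c.
Proof.
move=> cQ cO; split=> //; have [n hn] := Zp_approx hp 1 cQ cO.
have -> : c ^+ p - c = (c ^+ p - n%:R ^+ p) + (n%:R ^+ p - n%:R) - (c - n%:R) by ring.
apply: rpredB; last exact: hn.
apply: rpredD; last exact: natr_frob.
rewrite subrXX vballMr // rpred_sum // => i _.
by rewrite rpredM ?rpredX ?natr_ring.
Qed.

(** Frobenius modulo p acts on a polynomial over Z_p only through X |-> X^p. *)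
Lemma frob_poly (f : {poly C}) : (forall i, frob_fixed f`_i) ->
  f ^+ p - (f \Po 'X^p) \is a polyOver (B 1).
Proof.
move=> fF; have fO : f \is a polyOver O by apply/polyOverP => i; case: (fF i).
rewrite comp_polyE -{1}(coefK f) poly_def.
set s := \sum_(i < _) _ in |- *; set t := (X in _ - X).
have -> : s ^+ p - t = (s ^+ p - \sum_(i < size f) (f`_i *: 'X^i) ^+ p)
                     + (\sum_(i < size f) (f`_i *: 'X^i) ^+ p - t) by ring.
rewrite rpredD //.
  apply: (@freshman_sum _ (fun i => f`_i *: 'X^i)) => i.
  by rewrite polyOverZ ?polyOverXn // (polyOverP fO).
rewrite -sumrB rpred_sum // => i _; rewrite exprZn -!exprM mulnC -scalerBl.
apply/polyOverP => j; rewrite coefZ vballMr //; first by case: (fF i).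
by rewrite coefXn rpred_nat.
Qed.

Lemma frob_horner (f : {poly C}) x : (forall i, frob_fixed f`_i) -> x \in O ->
  f.[x] ^+ p - f.[x ^+ p] \in B 1.
Proof.
move=> fF xO; have := horner_ball (frob_poly fF) xO.
by rewrite hornerD hornerN horner_exp horner_comp hornerXn.
Qed.

(** This is the coefficient of X^k in exp(pX). *)
Lemma pexp_ball k : (0 < k)%N -> (k`!%:R)^-1 * p%:R ^+ k \in B 1.
Proof.
move=> k0; have [n' cop e] := pfactor_coprime hp (fact_gt0 k).
have lt := logn_fact_lt hp k0; set t := logn p k`! in e lt.
have vn : v n'%:R = 0%E by apply: (natr_unit hp hC).
have p0 : (p%:R : C) != 0 by rewrite (natC_neq0 hp hC) ?prime_gt0.
have n0 := val_neq0 hC vn.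
have -> : (k`!%:R)^-1 * p%:R ^+ k = n'%:R^-1 * p%:R ^+ (k - t).-1 * p%:R :> C.
  rewrite e natrM natrX -mulrA -exprSr prednK ?subn_gt0 //.
  have -> : p%:R ^+ k = p%:R ^+ (k - t) * p%:R ^+ t :> C.
    by rewrite -exprD subnK // ltnW.
  by field; rewrite n0 expf_neq0.
rewrite vballMl ?pB1 // rpredM //; first by rewrite OE (val_inv hC n0 vn) oppr0.
by rewrite rpredX // natr_ring.
Qed.

Lemma map_texp N (f : {poly rat}) : map_poly rC (texp N f) = texp N (map_poly rC f).
Proof.
rewrite /texp rmorph_sum; apply: eq_bigr => k _ /=.
by rewrite map_polyZ /= rmorphXn fmorphV rmorph_nat.
Qed.

Lemma map_eqX N (f g : {poly rat}) : eqX N f g -> eqX N (map_poly rC f) (map_poly rC g).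
Proof. by move=> h i iN; rewrite !coef_map h. Qed.

Definition AHe N : {poly C} := map_poly rC (AHexp_poly p N).
Definition AHC N : {poly C} := map_poly rC (AHpoly p N).

Lemma AHeE N : AHe N = \poly_(i < N) ratr (AHexp p i).
Proof.
apply/polyP => i; rewrite coef_map !coef_poly.
by case: ifP => // _; apply: (rmorph0 rC).
Qed.

Lemma AHexp0 : AHexp p 0 = 1.
Proof. by rewrite AHexp_small ?prime_gt0 // fact0 invr1. Qed.

(** Dwork's lemma, by induction on k. Let E' be E truncated below degree k. The
coefficient of X^k in E(X)^p is that of E'(X)^p plus p times the k-th coefficient
of E, since E(0) = 1; in E(X^p) exp(pX) it is that of E'(X^p) modulo p. As E'(X)^p
and E'(X^p) agree modulo p, the k-th coefficient times p is divisible by p. *)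
Lemma AHexp_integral k : ratr (AHexp p k) \in O.
Proof.
have rC1 : ratr (AHexp p 0) = 1 :> C by rewrite AHexp0; exact: (rmorph1 rC).
elim/ltn_ind: k => -[_|k IH]; first by rewrite rC1 rpred1.
set k1 := k.+1 in IH *; set e := ratr _.
pose E' := AHe k1; pose E := AHe k1.+1.
have p0 := prime_gt0 hp; have p1 := prime_gt1 hp.
have E'O : E' \is a polyOver O.
  apply/polyOverP => i; rewrite /E' AHeE coef_poly.
  case: ifP => // ik; last exact: rpred0.
  exact: IH.
have E'F i : frob_fixed E'`_i.
  apply: Zp_frob; last exact: (polyOverP E'O).
  by rewrite /E' coef_map; apply: (ratr_Qp hC).
have EE' : E = E' + e *: 'X^k1.
  apply/polyP => i; rewrite /E /E' !AHeE coefD coefZ coefXn !coef_poly ltnS.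
  by case: ltngtP => [||->]; rewrite ?mulr0 ?mulr1 ?addr0 ?add0r.
pose T := texp k1.+1 (p%:R *: 'X : {poly C}).
have feq : eqX k1.+1 (E ^+ p) ((E \Po 'X^p) * T).
  have := map_eqX (AHexp_feq hp (ltn0Sn k1)).
  by rewrite rmorphXn rmorphM /= map_comp_poly map_polyXn map_texp map_polyZ /=
             map_polyX /= rmorph_nat.
have T1 : T - 1 \is a polyOver (B 1).
  rewrite /T /texp big_ord_recl /= expr0 fact0 invr1 scale1r addrAC subrr add0r.
  rewrite rpred_sum // => i _; rewrite exprZn scalerA.
  apply/polyOverP => j; rewrite coefZ vballMr ?pexp_ball //.
  by rewrite coefXn rpred_nat.
have EX : eqX k1.+1 (E \Po 'X^p) (E' \Po 'X^p).
  move=> i ik; rewrite !coef_comp_poly_Xn //; case: ifP => // _.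
  rewrite EE' coefD coefZ coefXn ltn_eqF ?mulr0 ?addr0 //.
  case: i ik => [|i] ik; first by rewrite div0n.
  exact: leq_trans (ltn_Pdiv p1 _) _.
have lhs : (E ^+ p)`_k1 = (E' ^+ p)`_k1 + e * p%:R.
  have -> : E ^+ p = E' ^+ p + (E ^+ p - E' ^+ p) by ring.
  rewrite coefD subrXX EE' [X in X - E']addrC addrK -scalerAl coefZ coefXnM ltnn subnn.
  congr (_ + _ * _); rewrite -horner_coef0 horner_sum.
  rewrite (eq_bigr (fun=> 1)) ?sumr_const ?card_ord // => i _.
  have E'0 : E'.[0] = 1 by rewrite horner_coef0 /E' AHeE coef_poly.
  rewrite hornerM !horner_exp hornerD hornerZ hornerXn E'0 expr0n mulr0 addr0.
  by rewrite !expr1n mulr1.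
have pe : e * p%:R \in B 1.
  have -> : e * p%:R = ((E \Po 'X^p) * T)`_k1 - (E' ^+ p)`_k1.
    by rewrite -feq // lhs; ring.
  rewrite (eqXM EX (@eqX_refl _ _ T)) // -coefB.
  apply/polyOverP.
  have -> : (E' \Po 'X^p) * T - E' ^+ p =
    (E' \Po 'X^p) * (T - 1) - (E' ^+ p - (E' \Po 'X^p)) by ring.
  by rewrite rpredB ?frob_poly // polyOver_ballMl // polyOver_comp // polyOverXn.
have p0C : (p%:R : C) != 0 by rewrite (natC_neq0 hp hC).
have -> : e = (e * p%:R) * p%:R^-1 by rewrite mulfK.
rewrite O_B0 -(subrr 1) vballM // BE (val_inv hC p0C (Cp_valp hC)) //.
Qed.

Lemma AHe_ring N : AHe N \is a polyOver O.
Proof.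
apply/polyOverP => i; rewrite AHeE coef_poly; case: ifP => _; last exact: rpred0.
exact: AHexp_integral.
Qed.
End Integrality.

(** * Limits and values of power series *)

Section Limits.
Variables (R : realType) (p : nat) (hp : prime p) (C : fieldType).
Variables (v : C -> \bar R) (hC : is_Cp v p).
Notation O := (vring hC).
Notation B := (vball hC).

Lemma val_cvgP (u : nat -> C) l :
  val_cvg v u l <-> forall A : R, exists K, forall n, (K <= n)%N -> u n - l \in B A.
Proof.
split=> [/cvgeyPge h A|h]; first by have [K _ hK] := h A; exists K => n; exact: hK.
by apply/cvgeyPge => A; have [K hK] := h A; exists K => // n; exact: hK.
Qed.

Lemma val_cauchyP (u : nat -> C) :
  (forall A : R, exists K, forall n m,
     (K <= n)%N -> (K <= m)%N -> u n - u m \in B A) ->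
  val_cauchy v u.
Proof.
move=> h; apply/cvgeyPge => A; have [K hK] := h A.
exists ([set n | (K <= n)%N], [set n | (K <= n)%N]); first by split; exists K.
by move=> [n m] [/= hn hm]; exact: hK.
Qed.

Lemma ball_all0 x : (forall A : R, x \in B A) -> x = 0.
Proof.
move=> h; apply/eqP/negP => /negP /(val_fin hC) [r vr].
by have := h (r + 1); rewrite BE vr lee_fin gerDl ler10.
Qed.

Lemma val_cvg_unique (u : nat -> C) l l' : val_cvg v u l -> val_cvg v u l' -> l = l'.
Proof.
move=> /val_cvgP h /val_cvgP h'; apply/subr0_eq/ball_all0 => A.
have [K hK] := h A; have [K' hK'] := h' A; pose n := maxn K K'.
have -> : l - l' = (u n - l') - (u n - l) by ring.
by rewrite rpredB ?hK ?hK' // ?leq_maxl ?leq_maxr.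
Qed.

(** In a complete ultrametric field a series converges as soon as its terms tend to
0, and its remainders are as small as its terms. *)
Lemma val_geo_cvg (u : nat -> C) (r : R) : 0 < r ->
  (forall n, u n.+1 - u n \in B (n%:R * r)) ->
  exists2 l, val_cvg v u l & forall n, u n - l \in B (n%:R * r).
Proof.
move=> r0 hu.
have hum n k : u (n + k)%N - u n \in B (n%:R * r).
  elim: k => [|k IH]; first by rewrite addn0 subrr rpred0.
  rewrite addnS; have -> : u (n + k).+1 - u n =
    (u (n + k).+1 - u (n + k)%N) + (u (n + k)%N - u n) by ring.
  rewrite rpredD //; apply: (vball_le _ (hu _)).
  by rewrite ler_wpM2r ?(ltW r0) // ler_nat leq_addr.
have bound (A : R) : exists K : nat, A <= K%:R * r.
  exists (Num.bound `|A / r|); rewrite -ler_pdivrMr //.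
  exact: le_trans (ler_norm _) (ltW (archi_boundP (normr_ge0 _))).
have [l hl] : exists l, val_cvg v u l.
  apply: (Cp_complete hC); apply: val_cauchyP => A; have [K hK] := bound A.
  exists K => n m Kn Km; apply: (vball_le hK).
  have -> : u n - u m = (u n - u K) - (u m - u K) by ring.
  by rewrite -(subnKC Kn) -(subnKC Km) rpredB.
exists l => // n; have /val_cvgP/(_ (n%:R * r)) [K hK] := hl.
have -> : u n - l = (u (n + K)%N - l) - (u (n + K)%N - u n) by ring.
by rewrite rpredB ?hK ?leq_addl.
Qed.

Lemma series_evalP (f : nat -> rat) (x : C) (r : R) : 0 < r ->
  (forall i, ratr (f i) \in O) -> x \in B r ->
  forall N, \sum_(i < N) ratr (f i) * x ^+ i - series_eval v f x \in B (N%:R * r).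
Proof.
move=> r0 fO xr.
have [|l hl hN] := @val_geo_cvg (fun n => \sum_(i < n) ratr (f i) * x ^+ i) r r0.
  by move=> n; rewrite big_ord_recr /= addrAC subrr add0r vballMl // vballX.
have : [set l | series_at v f x l] (series_eval v f x) by apply: (xgetI _ hl).
by move=> /(val_cvg_unique hl) <-.
Qed.

Lemma AHeE_horner N x :
  (AHe hp hC N).[x] = \sum_(i < N) ratr (AHexp p i) * x ^+ i.
Proof. by rewrite AHeE horner_poly. Qed.

Lemma zeta_approx (pi_ : nat -> C) l (r : R) N : 0 < r -> pi_ l \in B r ->
  (AHe hp hC N).[pi_ l] - zeta_p p v pi_ l \in B (N%:R * r).
Proof.
move=> r0 hpi; rewrite AHeE_horner /zeta_p /theta mulr1.
by apply: series_evalP => // i; apply: AHexp_integral.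
Qed.
End Limits.

(** * Polynomials modulo the maximal ideal *)

Section Residue.
Variables (R : realType) (p : nat) (hp : prime p) (C : fieldType).
Variables (v : C -> \bar R) (hC : is_Cp v p).
Notation O := (vring hC).
Notation B := (vball hC).
Notation M := (vmax hC).
Notation QpC := (Qp v).

Lemma val_unity x n : (0 < n)%N -> x ^+ n = 1 -> v x = 0%E.
Proof.
move=> n0 xn; have x0 : x != 0.
  by apply: contra_eq_neq xn => ->; rewrite expr0n gtn_eqF // eq_sym oner_eq0.
have [r vr] := val_fin hC x0.
have := val_expn hC n vr; rewrite xn (val_one hC) => -[] /esym/eqP.
by rewrite mulf_eq0 pnatr_eq0 gtn_eqF //= vr => /eqP ->.
Qed.

Lemma unity_ring x n : (0 < n)%N -> x ^+ n = 1 -> x \in O.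
Proof. by move=> n0 xn; rewrite OE (val_unity n0 xn). Qed.

(** If u = x/y is 1 modulo the maximal ideal but u <> 1, then 1 + u + ... + u^(n-1) is
both 0 and n modulo this ideal, while n is a unit. *)
Lemma unity_sep x y n : coprime p n -> (0 < n)%N ->
  x ^+ n = 1 -> y ^+ n = 1 -> x != y -> x - y \notin M.
Proof.
move=> cop n0 xn yn xy; apply/negP => dM.
have y0 : y != 0 := val_neq0 hC (val_unity n0 yn).
have yiO : y^-1 \in O by apply: (@unity_ring _ n); rewrite // exprVn yn invr1.
pose u := x / y; have un : u ^+ n = 1 by rewrite expr_div_n xn yn divr1.
have uO := unity_ring n0 un.
have u1 : u - 1 \in M.
  have -> : u - 1 = (x - y) * y^-1 by rewrite mulrBl divff.
  exact: maxMr.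
have s0 : \sum_(i < n) u ^+ i = 0.
  have : u ^+ n - 1 = 0 by rewrite un subrr.
  rewrite subrX1 => /eqP; rewrite mulf_eq0 subr_eq0 => /orP[/eqP u1'|/eqP //].
  by case/eqP: xy; rewrite -[x](mulfVK y0) -/u u1' mul1r.
have : n%:R \in M.
  have -> : n%:R = - \sum_(i < n) (u ^+ i - 1).
    by rewrite sumrB s0 sumr_const card_ord sub0r opprK.
  rewrite rpredN rpred_sum // => i _; rewrite subrX1 maxMr // rpred_sum // => j _.
  by rewrite rpredX.
by rewrite ME (natr_unit hp hC cop) ltxx.
Qed.

Lemma max_prime x y : x \in O -> y \in O -> x * y \in M -> (x \in M) || (y \in M).
Proof.
move=> xO yO; apply: contraLR; rewrite negb_or => /andP[xM yM].
by rewrite ME (Cp_valM hC) (val_unit xO xM) (val_unit yO yM) adde0 ltxx.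
Qed.

Lemma prod_notin_max (I : finType) (F : I -> C) :
  (forall i, F i \in O) -> (forall i, F i \notin M) -> \prod_i F i \notin M.
Proof.
move=> FO FM; suff [] : \prod_i F i \in O /\ \prod_i F i \notin M by [].
elim/big_ind: _ => // [|x y [xO xM] [yO yM]].
  by rewrite rpred1 max1.
split; first by rewrite rpredM.
by apply/negP => /(max_prime xO yO); rewrite (negPf xM) (negPf yM).
Qed.

Lemma det_ring n (A : 'M[C]_n) : (forall i j, A i j \in O) -> \det A \in O.
Proof.
move=> h; rewrite /determinant rpred_sum // => s _.
rewrite rpredM ?rpredX ?rpredN ?rpred1 //.
by rewrite rpred_prod.
Qed.

Lemma adj_ring n (A : 'M[C]_n) : (forall i j, A i j \in O) ->
  forall i j, (\adj A) i j \in O.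
Proof.
move=> h i j; rewrite mxE /cofactor rpredM ?rpredX ?rpredN ?rpred1 //.
by apply: det_ring => *; rewrite !mxE.
Qed.

(** A nonzero polynomial over the residue field has at most as many roots as its
degree. The coefficients are recovered from the values by Cramer's rule: the
Vandermonde determinant is a unit. *)
Lemma poly_roots_max k (f : {poly C}) (x : 'I_k -> C) :
  f \is a polyOver O -> (size f <= k)%N -> (forall i, x i \in O) ->
  (forall i j, i != j -> x i - x j \notin M) -> (forall i, f.[x i] \in M) ->
  f \is a polyOver M.
Proof.
move=> fO sf xO xM fx.
pose V := Vandermonde k (\row_j x j); pose c : 'rV_k := \row_i f`_i.
have VO i j : V i j \in O by rewrite !mxE rpredX.
have cV : c *m V = \row_j f.[x j].
  apply/rowP => j; rewrite !mxE (horner_coef_wide _ sf).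
  by apply: eq_bigr => i _; rewrite !mxE.
have dV : \det V \notin M.
  rewrite det_Vandermonde; apply: prod_notin_max => i.
    by apply: rpred_prod => j _; rewrite !mxE rpredB.
  rewrite big_mkcond /=; apply: prod_notin_max => j; case: ifP => ij;
    rewrite ?rpred1 ?max1 //.
    by rewrite !mxE rpredB.
  by rewrite !mxE xM // -val_eqE /= gtn_eqF.
apply/polyOverP => i; have [ik|ki] := ltnP i k; last first.
  by rewrite nth_default ?rpred0 // (leq_trans sf).
have : f`_i * \det V \in M.
  have -> : f`_i * \det V = (c *m V *m \adj V) 0 (Ordinal ik).
    rewrite -mulmxA mul_mx_adj mul_mx_scalar !mxE mulrC //.
  rewrite cV mxE rpred_sum // => j _; rewrite mxE maxMr //; exact: adj_ring.
move/(max_prime _ (det_ring VO)); rewrite (negPf dV) orbF; apply.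
exact: (polyOverP fO).
Qed.

(** Otherwise X^p - X would have the p + 1 roots 0, ..., p - 1, c in the residue
field. *)
Lemma residue_Fp c : c \in O -> c ^+ p - c \in M -> exists n : nat, c - n%:R \in M.
Proof.
move=> cO cM; apply: contrapT => hn.
have {}hn n : c - n%:R \notin M by apply/negP => h; apply: hn; exists n.
pose f : {poly C} := 'X^p - 'X.
pose x (i : 'I_p.+1) : C := if (i < p)%N then i%:R else c.
have sf : size f = p.+1.
  by rewrite size_polyDl ?size_polyXn // size_polyN size_polyX ltnS prime_gt1.
have : f \is a polyOver M.
  apply: (@poly_roots_max p.+1 _ x).
  - by rewrite rpredB // ?polyOverXn ?polyOverX.
  - by rewrite sf.
  - by move=> i; rewrite /x; case: ifP; rewrite ?natr_ring.
  - have sub (i j : nat) : (i < j)%N -> (j < p)%N -> (j%:R - i%:R : C) \notin M.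
      move=> ij jp; rewrite -natrB ?(ltnW ij) // (natr_in_max hp hC).
      by apply/negP => /dvdn_leq; lia.
    move=> i j; rewrite -val_eqE /x /= => ij.
    case: ifP => ip; case: ifP => jp.
    + have [h|h|h] := ltngtP i j; last by rewrite h eqxx in ij.
        by rewrite -opprB rpredN sub.
      by rewrite sub.
    + by rewrite -opprB rpredN hn.
    + exact: hn.
    + have := ltn_ord i; have := ltn_ord j; rewrite !ltnS.
      move: ij ip jp; lia.
  - move=> i; rewrite hornerD hornerN hornerXn hornerX /x; case: ifP => _ //.
    by apply: (vball_max (@ltr01 R)); exact: natr_frob.
move/polyOverP/(_ p); rewrite coefB coefXn coefX eqxx gtn_eqF ?prime_gt1 // subr0.
exact/negP/max1.
Qed.
End Residue.

(** * The conjugates of a root of unity of order p^m - 1 *)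

(** The map y |-> y^p permutes cyclically the conjugates y^(p^j), j < m. *)
Lemma orbit_big (T : Type) (idx : T) (op : Monoid.com_law idx) (A : nzRingType)
    (F : A -> T) (p m i : nat) (y : A) : y ^+ (p ^ m) = y ->
  \big[op/idx]_(j < m) F ((y ^+ (p ^ i)) ^+ (p ^ j)) =
  \big[op/idx]_(j < m) F (y ^+ (p ^ j)).
Proof.
move=> ym; elim: i => [|i IH]; first by rewrite expn0 expr1.
rewrite -IH; case: m ym {IH} => [|m] ym; first by rewrite !big_ord0.
rewrite big_ord_recr [RHS]big_ord_recl /= Monoid.mulmC; congr (op _ _).
  congr F; rewrite expn0 expr1 -exprM expnSr -mulnA -expnS mulnC exprM ym.
  by [].
by apply: eq_bigr => j _; rewrite -!exprM expnSr -mulnA -expnS.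
Qed.


Section SubfieldPred.
Variables (C : fieldType) (F : set C).
(** A subfield given as a set, together with its closure properties as canonical
instances. *)
Definition subfield_pred of is_subfield F : {pred C} := mem F.
Variable hF : is_subfield F.
HB.instance Definition _ := GRing.isDivringClosed.Build C (subfield_pred hF) hF.
Lemma subfield_predE x : (x \in subfield_pred hF) <-> F x.
Proof. by split=> [/set_mem|/mem_set]. Qed.
End SubfieldPred.

Lemma is_subfield_smallest (C : fieldType) (S : set C) :
  is_subfield (smallest (@is_subfield C) S).
Proof.
split.
- by apply/mem_set => A [[A1 _ _] _]; exact: set_mem A1.
- move=> x y /set_mem hx /set_mem hy; apply/mem_set => A hA; apply: set_mem.
  by case: (hA) => -[_ AB _] _; apply: AB; apply: mem_set; [exact: hx | exact: hy].
- move=> x y /set_mem hx /set_mem hy; apply/mem_set => A hA; apply: set_mem.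
  by case: (hA) => -[_ _ AD] _; apply: AD; apply: mem_set; [exact: hx | exact: hy].
Qed.

Section Unramified.
Variables (R : realType) (p : nat) (hp : prime p) (C : fieldType).
Variables (v : C -> \bar R) (hC : is_Cp v p).
Notation O := (vring hC).
Notation B := (vball hC).
Notation M := (vmax hC).
Notation Q := (subfield_pred (Qp_subfield hp hC)).

Variables (m : nat) (hm : (0 < m)%N) (w : C).
Hypothesis hw : (p ^ m - 1).-primitive_root w.
Notation n := (p ^ m - 1)%N.

Lemma q_gt1 : (1 < p ^ m)%N.
Proof. by rewrite -(expn0 p) ltn_exp2l ?prime_gt1. Qed.

Lemma n_gt0 : (0 < n)%N.
Proof. by rewrite subn_gt0 q_gt1. Qed.

Lemma p_coprime_n : coprime p n.
Proof.
have q1 := q_gt1; rewrite -(coprime_pexpl _ _ hm) subn1 coprime_sym.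
by rewrite coprimePn ?(ltnW q1).
Qed.

Lemma unity_pm (y : C) : y ^+ n = 1 -> y ^+ (p ^ m) = y.
Proof. by move=> yn; rewrite -(subnK (ltnW q_gt1)) addn1 exprSr yn mul1r. Qed.

Lemma w_unity k : (w ^+ k) ^+ n = 1.
Proof. by rewrite exprAC (prim_expr_order hw) expr1n. Qed.

Lemma w_ring k : w ^+ k \in O.
Proof. by apply: (unity_ring hC n_gt0 (w_unity k)). Qed.

Lemma w_sep y z : y ^+ n = 1 -> z ^+ n = 1 -> y != z -> y - z \notin M.
Proof. exact: (unity_sep hp hC p_coprime_n n_gt0). Qed.

Lemma orbit_inj (i j : 'I_m) : w ^+ (p ^ i) = w ^+ (p ^ j) -> i = j.
Proof.
move/eqP; rewrite (eq_prim_root_expr hw); have p1 := prime_gt1 hp.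
case: (leqP m 1) => m1.
  by move=> _; apply/val_inj => /=; have := ltn_ord i; have := ltn_ord j; lia.
have small (k : 'I_m) : (p ^ k < n)%N.
  have h1 : (p ^ k <= p ^ m.-1)%N by rewrite leq_exp2l // -ltnS prednK.
  have h2 : (p ^ m = p * p ^ m.-1)%N by rewrite -expnS prednK.
  have h3 : (p ^ 1 <= p ^ m.-1)%N by rewrite leq_exp2l //; lia.
  rewrite expn1 in h3; nia.
by rewrite !modn_small // => /eqP /(expnI p1) /val_inj.
Qed.

Lemma frob_fixed_Q c : c \in Q -> c \in O -> frob_fixed hC c.
Proof. by move=> /subfield_predE cQ cO; apply: Zp_frob. Qed.

(** The conjugates x^(p^k) behave, modulo p, as the images of x under the iterated
Frobenius. *)
Lemma frob_iter (f : {poly C}) x k :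
  f \is a polyOver Q -> f \is a polyOver O -> x \in O ->
  f.[x] ^+ (p ^ k) - f.[x ^+ (p ^ k)] \in M.
Proof.
move=> /polyOverP fQ fO xO; apply: (vball_max (@ltr01 R)).
elim: k => [|k IH]; first by rewrite expn0 !expr1 subrr rpred0.
rewrite expnSr !exprM; set a := f.[x] ^+ _ in IH *; set y := x ^+ (p ^ k) in IH *.
have yO : y \in O by rewrite rpredX.
have fyO : f.[y] \in O by rewrite rpred_horner.
have aO : a \in O by rewrite rpredX // rpred_horner.
have -> : a ^+ p - f.[y ^+ p] = (a ^+ p - f.[y] ^+ p) + (f.[y] ^+ p - f.[y ^+ p]) by ring.
apply: rpredD; last first.
  by apply: frob_horner => // i; apply: frob_fixed_Q; rewrite ?fQ // (polyOverP fO).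
rewrite subrXX vballMr // rpred_sum // => i _.
by apply: rpredM; apply: rpredX.
Qed.

(** For y = w this turns out to be the minimal polynomial of w over Q_p. *)
Definition orbit_poly (y : C) : {poly C} := \prod_(j < m) ('X - (y ^+ (p ^ j))%:P).

(** The same product with an indeterminate instead of y: the coefficients of the
former are the values at y of polynomials over Z, and so obey Frobenius
congruences. *)
Definition generic_orbit_poly : {poly {poly C}} :=
  \prod_(j < m) ('X - ('X^(p ^ j))%:P).

Lemma orbit_polyE y r : (orbit_poly y)`_r = (generic_orbit_poly`_r).[y].
Proof.
rewrite -[RHS]/(horner_eval y _) -coef_map.
suff -> : orbit_poly y = map_poly (horner_eval y) generic_orbit_poly by [].
rewrite [RHS]rmorph_prod; apply: eq_bigr => j _ /=.
by rewrite rmorphB /= map_polyX map_polyC /= /horner_eval hornerXn.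
Qed.

Lemma generic_orbit_over (S : subringClosed C) r :
  generic_orbit_poly`_r \is a polyOver S.
Proof.
apply/polyOverP: r; apply: rpred_prod => j _.
by rewrite polyOverXsubC polyOverXn.
Qed.

Lemma orbit_poly_frob (y : C) i : y ^+ n = 1 ->
  orbit_poly (y ^+ (p ^ i)) = orbit_poly y.
Proof.
move=> /unity_pm yq.
exact: (@orbit_big _ _ _ _ (fun x : C => 'X - x%:P) p m i y yq).
Qed.

Lemma orbit_poly_coef_ring r : (orbit_poly w)`_r \in O.
Proof. by rewrite orbit_polyE rpred_horner ?generic_orbit_over // (w_ring 1). Qed.

(** The r-th coefficient is the value at w of an integral polynomial which takes the
same value at w^p; so it is fixed by Frobenius modulo p. *)
Lemma orbit_poly_mod_p r : exists k : nat, (orbit_poly w)`_r - k%:R \in M.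
Proof.
apply: (residue_Fp hp (orbit_poly_coef_ring r)).
rewrite orbit_polyE.
have := frob_iter 1 (generic_orbit_over Q r) (generic_orbit_over O r) (w_ring 1).
by rewrite expn1 expr1 -orbit_polyE -(orbit_polyE (w ^+ p)) -[p in w ^+ p]expn1
  orbit_poly_frob // (w_unity 1).
Qed.

Lemma size_orbit_poly y : size (orbit_poly y) = m.+1.
Proof. by rewrite size_prod_XsubC [index_enum _]unlock -enumT size_enum_ord. Qed.

Lemma orbit_poly_root y (j : 'I_m) : (orbit_poly y).[y ^+ (p ^ j)] = 0.
Proof. by rewrite horner_prod (bigD1 j) //= hornerXsubC subrr mul0r. Qed.

(** Let g0 lift the reduction of the orbit polynomial to integral coefficients, and
take 1 - g0^(p^m - 1). At a conjugate of w, g0 is in the maximal ideal; at another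
root of unity it is a unit u with u^(p^m) = u modulo the maximal ideal. *)
Lemma orbit_indicator : exists eps : {poly C},
  [/\ eps \is a polyOver Q, eps \is a polyOver O,
      forall j : 'I_m, eps.[w ^+ (p ^ j)] - 1 \in M
    & forall x, x ^+ n = 1 -> (forall j : 'I_m, x != w ^+ (p ^ j)) -> eps.[x] \in M].
Proof.
have [k hk] := choice orbit_poly_mod_p.
pose g0 : {poly C} := \poly_(r < m.+1) (k r)%:R.
have g0_over (S : subringClosed C) : g0 \is a polyOver S.
  by apply/polyOverP => r; rewrite coef_poly; case: ifP; rewrite ?rpred_nat ?rpred0.
have g0Q : g0 \is a polyOver Q := g0_over Q.
have g0O : g0 \is a polyOver O := g0_over O.
have gg0 x : x \in O -> g0.[x] - (orbit_poly w).[x] \in M.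
  move=> xO; rewrite -opprB rpredN -hornerN -hornerD; apply: horner_max => //.
  apply/polyOverP => r; rewrite coefB coef_poly; case: ltnP => // rm.
  by rewrite nth_default ?subr0 ?rpred0 // size_orbit_poly.
exists (1 - g0 ^+ n); split; rewrite ?rpredB ?rpred1 ?rpredX //.
  move=> j; rewrite hornerD hornerN horner_exp hornerC addrAC subrr add0r rpredN.
  have h : g0.[w ^+ (p ^ j)] \in M.
    by rewrite -[X in X \in _]subr0 -(orbit_poly_root w j) gg0 // w_ring.
  by rewrite -(prednK n_gt0) exprS maxMr // rpredX // max_sub.
move=> x xn xj; have xO := unity_ring hC n_gt0 xn.
rewrite hornerD hornerN horner_exp hornerC; set u := g0.[x].
have uO : u \in O by rewrite rpred_horner.
have uM : u \notin M.
  apply/negP => uM; have : (orbit_poly w).[x] \in M.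
    have -> : (orbit_poly w).[x] = u - (u - (orbit_poly w).[x]) by ring.
    by rewrite rpredB // gg0.
  apply/negP; rewrite horner_prod; apply: prod_notin_max => j; rewrite hornerXsubC.
    by rewrite rpredB // w_ring.
  by rewrite w_sep // w_unity.
have := frob_iter m g0Q g0O xO; rewrite (unity_pm xn) -/u.
rewrite -[(p ^ m)%N](subnK (ltnW q_gt1)) addn1 exprSr -[X in _ - X]mul1r -mulrBl.
have dO : u ^+ n - 1 \in O by rewrite rpredB ?rpred1 ?rpredX.
by move/(max_prime dO uO); rewrite (negPf uM) orbF => h; rewrite -opprB rpredN subSS subn0.
Qed.
End Unramified.

(** * Rationality of sums over the conjugates *)

Section LimitAlgebra.
Variables (R : realType) (p : nat) (hp : prime p) (C : fieldType).
Variables (v : C -> \bar R) (hC : is_Cp v p).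
Notation O := (vring hC).
Notation B := (vball hC).
Notation M := (vmax hC).

Lemma val_cvgMr (u : nat -> C) l a :
  val_cvg v u l -> val_cvg v (fun k => u k * a) (l * a).
Proof.
move=> /(val_cvgP hC) h; apply/(val_cvgP hC) => A; have [s s0 sa] := some_ball hC a.
have [K hK] := h (A + s); exists K => k Kk; rewrite -mulrBl.
by have := vballM (hK k Kk) sa; rewrite addrK.
Qed.

Lemma val_cvg_sum (I : finType) (u : I -> nat -> C) (l : I -> C) :
  (forall i, val_cvg v (u i) (l i)) -> val_cvg v (fun k => \sum_i u i k) (\sum_i l i).
Proof.
move=> h; apply/(val_cvgP hC) => A.
have /choice [K hK] : forall i, exists K, forall k, (K <= k)%N -> u i k - l i \in B A.
  by move=> i; move/(val_cvgP hC): (h i); apply.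
exists (\max_i K i) => k hk; rewrite -sumrB rpred_sum // => i _.
by apply: hK; apply: leq_trans hk; exact: leq_bigmax.
Qed.

Lemma Qp_lim (u : nat -> C) l : (forall k, Qp v (u k)) -> val_cvg v u l -> Qp v l.
Proof.
move=> uQ /(val_cvgP hC) h; apply: (@Qp_closed _ _ _ _ hC) => r; have [K hK] := h r.
by exists (u K) => //; rewrite -opprB rpredN hK.
Qed.

Lemma max_ball x : x \in M -> exists2 r : R, 0 < r <= 1 & x \in B r.
Proof.
move=> xM; have [->|x0] := eqVneq x 0.
  by exists 1; rewrite ?ltr01 ?lexx // vball0.
have [r vr] := val_fin hC x0; move: xM; rewrite ME vr lte_fin => r0.
exists (Num.min r 1); first by rewrite lt_min r0 ltr01 ge_min lexx orbT.
by rewrite BE vr lee_fin ge_min lexx.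
Qed.

Lemma linear_unbounded (r A : R) : 0 < r -> exists K : nat, A <= K%:R * r.
Proof.
move=> r0; exists (Num.bound `|A / r|); rewrite -ler_pdivrMr //.
exact: le_trans (ler_norm _) (ltW (archi_boundP (normr_ge0 _))).
Qed.

Lemma pow_cvg0 x : x \in M -> val_cvg v (fun k => x ^+ (p ^ k)) 0.
Proof.
move=> /max_ball [r /andP[r0 _] xr]; apply/(val_cvgP hC) => A.
have [K hK] := linear_unbounded A r0; exists K => k Kk; rewrite subr0.
apply: (vball_le _ (vballX _ xr)); apply: le_trans hK _.
rewrite ler_wpM2r ?(ltW r0) // ler_nat (leq_trans Kk) // ltnW //.
by rewrite ltn_expl // prime_gt1.
Qed.

(** Raising to the power p adds at least r to the valuation of x - 1, if r <= 1 and
r bounds this valuation from below. *)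
Lemma pow_cvg1 x : x - 1 \in M -> val_cvg v (fun k => x ^+ (p ^ k)) 1.
Proof.
move=> /max_ball [r /andP[r0 r1] xr]; apply/(val_cvgP hC) => A.
have [K hK] := linear_unbounded A r0; exists K => k Kk.
suff h : x ^+ (p ^ k) - 1 \in B (k.+1%:R * r).
  apply: (vball_le _ h); apply: le_trans hK _.
  by rewrite ler_wpM2r ?(ltW r0) // ler_nat (leq_trans Kk).
elim: k {Kk} => [|k IH]; first by rewrite expn0 expr1 mul1r.
rewrite expnSr exprM; set y := x ^+ (p ^ k) in IH *.
have s0 : 0 <= k.+1%:R * r by rewrite mulr_ge0 ?ler0n ?(ltW r0).
have yO := vball_ring s0 IH.
have sS : k.+2%:R * r = k.+1%:R * r + r by rewrite -natr1 mulrDl mul1r.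
have -> : y ^+ p = (1 + (y - 1)) ^+ p by congr (_ ^+ p); ring.
rewrite expr_prime_add // expr1n.
set z := \sum_(i < _) _.
have -> : 1 + (y - 1) ^+ p + z *+ p - 1 = (y - 1) ^+ p + p%:R * z.
  by rewrite [p%:R * z]mulr_natl; ring.
apply: rpredD.
  apply: (vball_le _ (vballX _ IH)); rewrite mulrA -natrM ler_wpM2r ?(ltW r0) //.
  rewrite ler_nat; have := prime_gt1 hp; nia.
have : p%:R * z \in B (1 + k.+1%:R * r).
  apply: vballM; first exact: pB1.
  apply: rpred_sum => i _; rewrite rpredMn // expr1n mul1r exprSr vballMl //.
  by rewrite rpredX.
by apply: vball_le; rewrite sS addrC lerD2r.
Qed.
End LimitAlgebra.

Lemma sum_prim_root (K : fieldType) n (w : K) r : n.-primitive_root w ->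
  \sum_(i < n) (w ^+ i) ^+ r = if (n %| r)%N then n%:R else 0.
Proof.
move=> hw; under eq_bigr do rewrite exprAC.
have e : (n %| r)%N = (w ^+ r == 1) by rewrite (prim_order_dvd hw).
rewrite e; case: eqP => [->|/eqP wr].
  by under eq_bigr do rewrite expr1n; rewrite sumr_const card_ord.
have : (w ^+ r) ^+ n - 1 = 0 by rewrite exprAC (prim_expr_order hw) expr1n subrr.
by rewrite subrX1 => /eqP; rewrite mulf_eq0 subr_eq0 (negPf wr) => /eqP.
Qed.

Section TraceRational.
Variables (R : realType) (p : nat) (hp : prime p) (C : fieldType).
Variables (v : C -> \bar R) (hC : is_Cp v p).
Notation O := (vring hC).
Notation M := (vmax hC).
Notation Q := (subfield_pred (Qp_subfield hp hC)).
Variables (m : nat) (hm : (0 < m)%N) (w : C).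
Hypothesis hw : (p ^ m - 1).-primitive_root w.
Notation n := (p ^ m - 1)%N.

Lemma sum_unity_Q (f : {poly C}) : f \is a polyOver Q -> \sum_(i < n) f.[w ^+ i] \in Q.
Proof.
move=> /polyOverP fQ; under eq_bigr do rewrite horner_coef.
rewrite exchange_big rpred_sum //= => r _; rewrite -mulr_sumr rpredM //.
by rewrite (sum_prim_root _ hw); case: ifP; rewrite ?rpred_nat ?rpred0.
Qed.

(** The indicator of the conjugates of w on the roots of unity is the limit of the
p^k-th powers of a polynomial over Z_p; summing over all roots of unity exhibits
the sum over the conjugates as a limit of elements of Q_p. *)
Lemma orbit_sum_Q (f : {poly C}) : f \is a polyOver Q ->
  \sum_(j < m) f.[w ^+ (p ^ j)] \in Q.
Proof.
move=> fQ; have [e [eQ eO e1 e0]] := orbit_indicator hp hC hm hw.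
pose ix (j : 'I_m) := Ordinal (ltn_pmod (p ^ j) (n_gt0 hp hm)).
have wix j : w ^+ (ix j) = w ^+ (p ^ j) by rewrite /= (prim_expr_mod hw).
have ix_inj : injective ix.
  move=> i j /(congr1 (fun k : 'I_n => w ^+ k)).
  by rewrite !wix => /(orbit_inj hp hm hw).
pose orb := [set ix j | j in 'I_m]%SET.
have -> : \sum_(j < m) f.[w ^+ (p ^ j)] = \sum_(i < n) (i \in orb)%:R * f.[w ^+ i].
  under [RHS]eq_bigr do rewrite mulr_natl mulrb.
  rewrite -big_mkcond /= big_imset /=; last by move=> ? ? _ _; exact: ix_inj.
  by apply: eq_bigr => j _; rewrite (prim_expr_mod hw).
apply/(subfield_predE (Qp_subfield hp hC)).
apply: (Qp_lim hC (u := fun k => \sum_(i < n) (e ^+ (p ^ k) * f).[w ^+ i])).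
  move=> k; apply/(subfield_predE (Qp_subfield hp hC))/sum_unity_Q.
  by rewrite rpredM // rpredX.
apply: (val_cvg_sum hC) => i.
under eq_fun do rewrite hornerM horner_exp.
apply: (val_cvgMr hC); case: (boolP (i \in orb)) => io.
  by apply: (pow_cvg1 hp (hC := hC)); case/imsetP: io => j _ ->; rewrite wix.
apply: (pow_cvg0 hp (hC := hC)); apply: e0; first exact: w_unity.
move=> j; apply: contra io => /eqP h; apply/imsetP; exists j => //.
have : w ^+ i == w ^+ (ix j) by rewrite wix h.
by rewrite (eq_prim_root_expr hw) !modn_small // => /eqP /val_inj.
Qed.

(** The sum over the conjugates is m c. *)
Lemma orbit_inv_Q (f : {poly C}) c : f \is a polyOver Q ->
  (forall j : 'I_m, f.[w ^+ (p ^ j)] = c) -> c \in Q.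
Proof.
move=> fQ h; have := orbit_sum_Q fQ; under eq_bigr do rewrite h.
rewrite sumr_const card_ord -mulr_natl => mc.
have m0 : (m%:R : C) != 0 by rewrite (natC_neq0 hp hC).
by rewrite -[c](mulKf m0) rpredM // rpredV rpred_nat.
Qed.

Lemma orbit_poly_Q : orbit_poly p m w \is a polyOver Q.
Proof.
apply/polyOverP => r; apply: (@orbit_inv_Q (generic_orbit_poly p C m)`_r).
  exact: (generic_orbit_over p m Q r).
by move=> j; rewrite -orbit_polyE (orbit_poly_frob hp hm) // (w_unity hw 1).
Qed.

(** Divide a relation by a coefficient of least valuation. By Frobenius it then holds
modulo the maximal ideal at the m conjugates of w, which are distinct modulo this
ideal: all its coefficients would be in the maximal ideal, but one of them is 1. *)
Lemma w_independent (f : {poly C}) : f \is a polyOver Q -> (size f <= m)%N ->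
  f.[w] = 0 -> f = 0.
Proof.
move=> fQ sf fw; apply/eqP/negP => /negP f0.
have sf0 : (0 < size f)%N by rewrite size_poly_gt0.
have li : ((size f).-1 < size f)%N by rewrite prednK.
have [i0 _ i0min] :=
  @arg_minP _ _ _ (Ordinal li) predT (fun i : 'I_(size f) => v f`_i) isT.
have c0 : f`_i0 != 0.
  apply/eqP => e; have := i0min (Ordinal li) isT.
  rewrite e (Cp_val0 hC) leye_eq => /eqP h.
  have : f`_(size f).-1 != 0 by rewrite -lead_coefE lead_coef_eq0.
  by move=> /(Cp_val_fin hC); rewrite h.
pose g := (f`_i0)^-1 *: f.
have gQ : g \is a polyOver Q by rewrite polyOverZ // rpredV (polyOverP fQ).
have gO : g \is a polyOver O.
  apply/polyOverP => i; rewrite coefZ; have [ilt|ige] := ltnP i (size f); last first.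
    by rewrite [f`_i]nth_default // mulr0 rpred0.
  have := i0min (Ordinal ilt) isT => /= le.
  have [r vr] := val_fin hC c0; rewrite OE (Cp_valM hC) (val_inv hC c0 vr).
  by rewrite EFinN addeC sube_ge0 // -vr.
have gM : g \is a polyOver M.
  apply: (@poly_roots_max _ _ _ _ hC m g (fun j : 'I_m => w ^+ (p ^ j))) => //.
  - by apply: leq_trans sf; exact: size_scale_leq.
  - by move=> j; exact: (w_ring hp hC hm hw).
  - move=> i j ij; apply: (w_sep hp hC hm); rewrite ?(w_unity hw) //.
    by apply: contra ij => /eqP /(orbit_inj hp hm hw) ->.
  - move=> j; have := frob_iter j gQ gO (w_ring hp hC hm hw 1).
    rewrite expr1 /g hornerZ fw mulr0 expr0n gtn_eqF ?expn_gt0 ?prime_gt0 //.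
    by rewrite sub0r rpredN.
move/polyOverP/(_ i0): gM; rewrite coefZ mulVf //; exact/negP/max1.
Qed.

(** The remainder of [f] modulo the orbit polynomial. *)
Lemma reduce_Q (f : {poly C}) : f \is a polyOver Q ->
  exists2 r : {poly C}, r \is a polyOver Q /\ (size r <= m)%N
    & forall j : 'I_m, f.[w ^+ (p ^ j)] = r.[w ^+ (p ^ j)].
Proof.
move: {2}(size f) (leqnn (size f)) => s; elim: s f => [|s IH] f sf fQ.
  by exists f => //; split=> //; apply: leq_trans sf _.
have [fm|fm] := leqP (size f) m; first by exists f.
pose g := orbit_poly p m w.
have g_monic : g \is monic by exact: monic_prod_XsubC.
have sg : size g = m.+1 by exact: size_orbit_poly.
have f0 : f != 0 by rewrite -size_poly_gt0 (leq_ltn_trans _ fm).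
pose h := lead_coef f *: ('X^(size f - m.+1) * g).
have hQ : h \is a polyOver Q.
  rewrite polyOverZ ?lead_coefE ?(polyOverP fQ) // rpredM ?polyOverXn //.
  exact: orbit_poly_Q.
have sh : size h = size f.
  rewrite size_scale ?lead_coef_eq0 // size_monicM ?monicXn ?monic_neq0 //.
  rewrite size_polyXn sg addSn /= subnK //.
have lh : lead_coef h = lead_coef f.
  by rewrite lead_coefZ lead_coef_Mmonic // lead_coefXn mulr1.
have [||r rQ rf] := IH (f - h).
- rewrite -ltnS; apply: leq_trans sf.
  rewrite -(prednK (leq_ltn_trans (leq0n _) fm)) ltnS.
  apply/leq_sizeP => i; rewrite leq_eqVlt => /orP[/eqP <-|].
    by rewrite coefB -{2}sh -!lead_coefE lh subrr.
  rewrite prednK ?(leq_ltn_trans (leq0n _) fm) // => fi.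
  by rewrite coefB !nth_default ?subrr // sh.
- by rewrite rpredB.
exists r => // j; rewrite -rf hornerD hornerN /h hornerZ hornerM orbit_poly_root.
by rewrite !mulr0 subr0.
Qed.
End TraceRational.

(** * The trace of K_m over Q_p *)

Section TraceFormula.
Variables (R : realType) (p : nat) (hp : prime p) (C : fieldType).
Variables (v : C -> \bar R) (hC : is_Cp v p).
Notation O := (vring hC).
Notation M := (vmax hC).
Notation Q := (subfield_pred (Qp_subfield hp hC)).

Section Conjugates.
Variables (m : nat) (hm : (0 < m)%N) (w : C).
Hypothesis hw : (p ^ m - 1).-primitive_root w.

Lemma conj_root (f : {poly C}) : f \is a polyOver Q -> f.[w] = 0 ->
  forall j : 'I_m, f.[w ^+ (p ^ j)] = 0.
Proof.
move=> fQ fw; have [r [rQ sr] rf] := reduce_Q hm hw fQ.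
suff r0 : r = 0 by move=> j; rewrite rf r0 horner0.
apply: (w_independent hm hw rQ sr).
by have := rf (Ordinal hm); rewrite /= expn0 expr1 fw.
Qed.
End Conjugates.

Variables (m : nat) (hm : (0 < m)%N) (w : C).
Hypothesis hw : (p ^ m - 1).-primitive_root w.
Notation n := (p ^ m - 1)%N.
Notation K := (Kunr v w).

(** w is itself a conjugate of each of its conjugates, with the same orbit. *)
Lemma conj_root_inv (f : {poly C}) (j : 'I_m) : f \is a polyOver Q ->
  f.[w ^+ (p ^ j)] = 0 -> f.[w] = 0.
Proof.
move=> fQ fj; have [j0|j0] := posnP j; first by move: fj; rewrite j0 expn0 expr1.
have hw' : n.-primitive_root (w ^+ (p ^ j)).
  by rewrite (prim_root_exp_coprime _ hw) coprimeXl // (p_coprime_n hp hm).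
have jm : (m - j < m)%N by have := ltn_ord j; lia.
have := conj_root hm hw' fQ fj (Ordinal jm).
rewrite -exprM -expnD /= subnKC ?(ltnW (ltn_ord j)) //.
by rewrite (unity_pm hp hm (w_unity hw 1)).
Qed.

(** The ring Q_p[w], which is to be shown to be the field K_m. *)
Definition w_span : set C :=
  [set y | exists2 f : {poly C}, f \is a polyOver Q & y = f.[w]].

(** The inverse of f(w) is the product of its other conjugates divided by its norm,
and the norm is a nonzero element of Q_p. *)
Lemma w_span_subfield : is_subfield w_span.
Proof.
have hV x : w_span x -> w_span x^-1.
  move=> [f fQ ->]; have [f0|f0] := eqVneq f.[w] 0.
    by exists 0; rewrite ?rpred0 // f0 invr0 horner0.
  pose F (j : nat) := f \Po 'X^(p ^ j).
  have FQ j : F j \is a polyOver Q by rewrite polyOver_comp // polyOverXn.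
  have FE j y : (F j).[y] = f.[y ^+ (p ^ j)] by rewrite horner_comp hornerXn.
  pose N := \prod_(j < m) (F j).[w].
  have NQ : N \in Q.
    apply: (orbit_inv_Q hm hw (f := \prod_(j < m) F j)); first by rewrite rpred_prod.
    move=> i; rewrite horner_prod /N; under eq_bigr do rewrite FE.
    under [RHS]eq_bigr do rewrite FE.
    have wq := unity_pm hp hm (w_unity hw 1).
    exact: (@orbit_big _ _ _ _ (fun x : C => f.[x]) p m i w wq).
  have N0 : N != 0.
    apply/prodf_neq0 => j _; rewrite FE; apply: contra f0 => /eqP h.
    by rewrite (conj_root_inv fQ h).
  exists (N^-1 *: \prod_(j < m | j != Ordinal hm) F j).
    by rewrite polyOverZ ?rpredV // rpred_prod.
  rewrite hornerZ horner_prod; apply: (mulIf f0); rewrite mulVf // -mulrA [_ * f.[w]]mulrC.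
  have -> : f.[w] = (F (Ordinal hm)).[w] by rewrite FE /= expn0 expr1.
  by rewrite -(bigD1 (Ordinal hm) (P := predT) (F := fun j => (F j).[w])) //= -/N mulVf.
split.
- by apply: mem_set; exists 1; rewrite ?rpred1 // hornerC.
- move=> x y /set_mem [f fQ ->] /set_mem [g gQ ->]; apply: mem_set.
  by exists (f - g); rewrite ?rpredB // hornerD hornerN.
- move=> x y /set_mem [f fQ ->] /set_mem /hV [g gQ ->]; apply: mem_set.
  by exists (f * g); rewrite ?rpredM // hornerM.
Qed.

Lemma K_subfield : is_subfield K. Proof. exact: is_subfield_smallest. Qed.

Lemma Qp_sub_K x : Qp v x -> K x.
Proof. by move=> h A [_ sA]; apply: sA; left. Qed.

Lemma w_in_K : K w. Proof. by move=> A [_ sA]; apply: sA; right. Qed.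

Lemma K_wpow k : K (w ^+ k).
Proof.
apply/(subfield_predE K_subfield); apply: rpredX; apply/(subfield_predE K_subfield).
exact: w_in_K.
Qed.

Lemma K_spanE y : K y ->
  exists2 f : {poly C}, f \is a polyOver Q /\ (size f <= m)%N & y = f.[w].
Proof.
move=> Ky; have [f fQ ->] : w_span y.
  apply: Ky; split; first exact: w_span_subfield.
  move=> x [xQ|->].
    exists x%:P; rewrite ?hornerC // polyOverC.
    exact/(subfield_predE (Qp_subfield hp hC)).
  by exists 'X; rewrite ?polyOverX ?hornerX.
have [r rQ rf] := reduce_Q hm hw fQ; exists r => //.
by have := rf (Ordinal hm); rewrite /= expn0 expr1.
Qed.

Definition wbasis : 'cV[C]_m := \col_i w ^+ i.

Lemma row_wbasis (c : 'rV[C]_m) : (c *m wbasis) 0 0 = (rVpoly c).[w].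
Proof.
rewrite mxE (horner_coef_wide _ (size_poly _ _)); apply: eq_bigr => i _.
by rewrite coef_rVpoly_ord mxE.
Qed.

Lemma rVpoly_over (c : 'rV[C]_m) : c \is a mxOver Q -> rVpoly c \is a polyOver Q.
Proof.
move=> /mxOverP cQ; apply/polyOverP => i; rewrite coef_rVpoly.
by case: insub => [j|]; rewrite ?rpred0.
Qed.

Lemma wbasis_is_basis : is_basis (Qp v) K wbasis.
Proof.
split=> [i|y Ky]; first by rewrite mxE; exact: K_wpow.
have [f [fQ sf] ->] := K_spanE Ky.
exists (poly_rV f); split.
  split; last by rewrite row_wbasis poly_rV_K.
  by apply/mxOverP => i j; rewrite mxE; exact: (polyOverP fQ).
move=> c [cQ]; rewrite row_wbasis => e.
have h0 : f - rVpoly c = 0.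
  apply: (@w_independent _ _ hp _ _ hC _ hm _ hw); first by rewrite rpredB // rVpoly_over.
    rewrite (leq_trans (size_polyD _ _)) // geq_max sf size_polyN; exact: size_poly.
  by rewrite hornerD hornerN e subrr.
by rewrite (subr0_eq h0) rVpolyK.
Qed.

(** Matrices of the same multiplication in two bases are conjugate under the change of
basis matrices, whose products both ways are identities. *)
Lemma is_trace_unique x t t' :
  is_trace (Qp v) K x t -> is_trace (Qp v) K x t' -> t = t'.
Proof.
move=> [d [e [A [[eK eU] AQ xe ->]]]] [d' [e' [A' [[e'K e'U] A'Q xe' ->]]]].
have coords k k' (f : 'cV[C]_k) (f' : 'cV[C]_k') : (forall i, K (f i 0)) ->
   is_basis (Qp v) K f' -> exists2 P : 'M[C]_(k, k'), P \is a mxOver Q & f = P *m f'.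
  move=> fK [_ f'U]; have /choice [c hc] : forall i, exists c : 'rV[C]_k',
      c \is a mxOver Q /\ f i 0 = (c *m f') 0 0.
    by move=> i; have [c [hc _]] := f'U _ (fK i); exists c.
  exists (\matrix_i c i).
    by apply/mxOverP => i j; rewrite mxE; case: (hc i) => /mxOverP h _; exact: h.
  apply/colP => i; rewrite (proj2 (hc i)) !mxE; apply: eq_bigr => j _.
  by rewrite mxE.
have uniq k k' (f : 'cV[C]_k) (P P' : 'M[C]_(k', k)) : is_basis (Qp v) K f ->
    P \is a mxOver Q -> P' \is a mxOver Q -> P *m f = P' *m f -> P = P'.
  move=> [fK fU] /mxOverP PQ /mxOverP PQ' ePP; apply/row_matrixP => i.
  have KPf : K ((P *m f) i 0).
    apply/(subfield_predE K_subfield); rewrite mxE rpred_sum // => j _.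
    rewrite rpredM //; apply/(subfield_predE K_subfield); last exact: fK.
    by apply: Qp_sub_K; apply/(subfield_predE (Qp_subfield hp hC)); exact: PQ.
  have [c [_ hc]] := fU _ KPf.
  have rowE (T : 'M[C]_(k', k)) :
      (forall i j, T i j \in Q) -> T *m f = P *m f -> c = row i T.
    move=> TQ eT; apply: hc; split.
      by apply/mxOverP => a b; rewrite mxE; exact: TQ.
    by rewrite -row_mul eT [RHS]mxE.
  by rewrite -(rowE P) // -(rowE P').
have [P PQ eP] := coords _ _ e e' eK (conj e'K e'U).
have [P' PQ' eP'] := coords _ _ e' e e'K (conj eK eU).
have PP' : P *m P' = 1%:M.
  apply: (uniq _ _ e _ _ (conj eK eU)); first exact: mxOverM.
    by apply: mxOver_scalar; rewrite ?rpred0 ?rpred1.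
  by rewrite -mulmxA -eP' -eP mul1mx.
have A'E : P *m A' *m P' = A.
  apply: (uniq _ _ e _ _ (conj eK eU)) => //; first by rewrite !mxOverM.
  by rewrite -mulmxA -eP' -mulmxA -xe' -scalemxAr -eP.
have P'P : P' *m P = 1%:M.
  apply: (uniq _ _ e' _ _ (conj e'K e'U)); first exact: mxOverM.
    by apply: mxOver_scalar; rewrite ?rpred0 ?rpred1.
  by rewrite -mulmxA -eP -eP' mul1mx.
by rewrite -A'E mxtrace_mulC mulmxA P'P mul1mx.
Qed.

(** A relation over Q_p satisfied by w holds for its conjugates; so the Vandermonde
matrix of the conjugates of w diagonalizes multiplication by w^k. *)
Lemma trace_wpow k : is_trace (Qp v) K (w ^+ k) (\sum_(j < m) (w ^+ k) ^+ (p ^ j)).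
Proof.
have hb := wbasis_is_basis.
have /choice [c hc] : forall i : 'I_m, exists c : 'rV[C]_m,
    c \is a mxOver Q /\ w ^+ (k + i) = (c *m wbasis) 0 0.
  by move=> i; have [c [hc _]] := hb.2 _ (K_wpow (k + i)); exists c.
pose A : 'M[C]_m := \matrix_i c i.
have rowA i : row i A = c i by rewrite rowK.
exists m, wbasis, A; split => //.
- by apply/mxOverP => i j; rewrite mxE; case: (hc i) => /mxOverP h _; exact: h.
- apply/colP => i; rewrite !mxE -exprD (proj2 (hc i)) mxE.
  by apply: eq_bigr => j _; rewrite !mxE.
pose V := Vandermonde m (\row_(j < m) w ^+ (p ^ j)).
pose D : 'M[C]_m := diag_mx (\row_(j < m) (w ^+ k) ^+ (p ^ j)).
have AV : A *m V = V *m D.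
  apply/matrixP => i j; rewrite mul_mx_diag !mxE.
  pose f := 'X^(k + i) - rVpoly (c i).
  have fQ : f \is a polyOver Q.
    by rewrite rpredB ?polyOverXn // rVpoly_over //; case: (hc i).
  have fw : f.[w] = 0.
    by rewrite /f hornerD hornerN hornerXn -row_wbasis (proj2 (hc i)) subrr.
  have /eqP := conj_root hm hw fQ fw j.
  rewrite /f hornerD hornerN hornerXn subr_eq0 => /eqP e.
  transitivity ((w ^+ (p ^ j)) ^+ (k + i)); last first.
    by rewrite exprD mulrC [in RHS]exprAC.
  rewrite e (horner_coef_wide _ (size_poly _ _)); apply: eq_bigr => r _.
  by rewrite coef_rVpoly_ord !mxE.
have Vu : V \in unitmx.
  rewrite unitmxE unitfE det_Vandermonde; apply/prodf_neq0 => i _.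
  apply/prodf_neq0 => j ij; rewrite !mxE subr_eq0.
  apply/eqP => /(orbit_inj hp hm hw) e.
  by rewrite e ltnn in ij.
have -> : A = V *m D *m invmx V by rewrite -AV mulmxK.
rewrite mxtrace_mulC mulmxA mulVmx // mul1mx mxtrace_diag.
by apply: eq_bigr => j _; rewrite mxE.
Qed.

Lemma field_trace_wpow k :
  field_trace (Qp v) K (w ^+ k) = \sum_(j < m) (w ^+ k) ^+ (p ^ j).
Proof.
have h := trace_wpow k.
by apply: (is_trace_unique (t' := \sum_(j < m) _)) (h); exact: (xgetI 0 h).
Qed.
End TraceFormula.

(** * Eisenstein coordinates and inversion of the Artin-Hasse exponential *)

Section EisensteinCoordinates.
Variables (R : realType) (p : nat) (hp : prime p) (C : fieldType).
Variables (v : C -> \bar R) (hC : is_Cp v p).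
Notation O := (vring hC).
Notation B := (vball hC).
Notation M := (vmax hC).
Variables (D : nat) (D0 : (0 < D)%N) (lam : C).
Notation r0 := ((D%:R : R)^-1).
Hypothesis vlam : v lam = r0%:E.
Notation ev f x := ((map_poly (intr : int -> C) f).[x]).

Lemma r0_gt0 : 0 < r0. Proof. by rewrite invr_gt0 ltr0n. Qed.

Lemma r0_D : D%:R * r0 = 1. Proof. by rewrite divff // pnatr_eq0 -lt0n. Qed.

Lemma lam_pow_ball i j : (i <= j)%N -> lam ^+ j \in B (i%:R * r0).
Proof.
move=> ij; rewrite BE (val_expn hC _ vlam) lee_fin ler_wpM2r ?(ltW r0_gt0) //.
by rewrite ler_nat.
Qed.

Lemma lam_ring : lam \in O.
Proof. by have := lam_pow_ball (leq0n 1); rewrite mul0r -O_B0 expr1. Qed.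

Lemma ev_wide (f : {poly int}) : (size f <= D)%N ->
  ev f lam = \sum_(i < D) (f`_i)%:~R * lam ^+ i.
Proof.
move=> sf; have sf' : (size (map_poly (intr : int -> C) f) <= D)%N.
  exact: leq_trans (size_poly _ _) sf.
by rewrite (horner_coef_wide _ sf'); apply: eq_bigr => i _; rewrite coef_map.
Qed.

(** The valuations of the c_i lam^i, with c_i in Z nonzero and i < D, are pairwise
distinct modulo 1; hence divisibility by p can be read coordinate by coordinate. *)
Lemma ev_ball1_dvd (f : {poly int}) : (size f <= D)%N -> ev f lam \in B 1 ->
  forall i, (p%:Z %| f`_i)%Z.
Proof.
move=> sf f1; elim/ltn_ind => i IH; have [iD|Di] := ltnP i D; last first.
  by rewrite nth_default ?dvdz0 // (leq_trans sf).
have r0p := r0_gt0; have i1 : i.+1%:R * r0 <= 1.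
  by rewrite -[X in _ <= X]r0_D ler_wpM2r ?(ltW r0p) // ler_nat.
have h : (f`_i)%:~R * lam ^+ i \in B (i.+1%:R * r0).
  have := f1; rewrite ev_wide // (bigD1 (Ordinal iD)) //=.
  set s := \sum_(_ < _ | _) _ => hs.
  have -> : (f`_i)%:~R * lam ^+ i = ((f`_i)%:~R * lam ^+ i + s) - s by ring.
  apply: rpredB; first exact: vball_le hs.
  apply: rpred_sum => j; rewrite -val_eqE /= => ji.
  have [lt|gt|e] := ltngtP j i; last by rewrite e eqxx in ji.
    apply: (vball_le i1); apply: vballMr; last by rewrite rpredX // lam_ring.
    by have := intr_ppow hC (k := 1); rewrite expr1; apply; exact: IH.
  by apply: vballMl; [exact: intr_ring | exact: lam_pow_ball].
rewrite -(intr_in_max hp hC); apply: (vball_max r0p).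
have l0 : lam ^+ i != 0 by rewrite expf_neq0 // (val_neq0 hC vlam).
have -> : (f`_i)%:~R = ((f`_i)%:~R * lam ^+ i) * (lam ^+ i)^-1 by rewrite mulfK.
have -> : r0 = i.+1%:R * r0 + - (i%:R * r0) by rewrite -natr1; ring.
by apply: vballM => //; rewrite BE (val_inv hC l0 (val_expn hC i vlam)).
Qed.

Lemma ev_ball_dvd k (f : {poly int}) : (size f <= D)%N -> ev f lam \in B k%:R ->
  forall i, (p%:Z ^+ k %| f`_i)%Z.
Proof.
elim: k f => [|k IH] f sf fk i; first by rewrite expr0 dvd1z.
have p0 : (p%:R : C) != 0 by rewrite (natC_neq0 hp hC) // prime_gt0.
have f1 : ev f lam \in B 1 by apply: (vball_le _ fk); rewrite ler1n.
have dv := ev_ball1_dvd sf f1.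
pose g : {poly int} := \poly_(i < D) (f`_i %/ p%:Z)%Z.
have fE : f = p%:Z *: g.
  apply/polyP => j; rewrite coefZ coef_poly; case: ltnP => jD.
    by rewrite mulrC divzK.
  by rewrite mulr0 nth_default // (leq_trans sf).
have gk : ev g lam \in B k%:R.
  have -> : ev g lam = ev f lam * p%:R^-1.
    by rewrite fE map_polyZ hornerZ /= mulrAC divff // mul1r.
  have -> : k%:R = k.+1%:R + -1 :> R by rewrite -natr1; ring.
  by apply: vballM => //; rewrite BE (val_inv hC p0 (Cp_valp hC)).
by rewrite fE coefZ exprS dvdz_mul // IH // size_poly.
Qed.

(** The coordinates of approximations that differ by an element of valuation k differ
by multiples of p^k, so they converge separately. *)
Lemma eisenstein_limit x : (forall k : nat, exists2 f : {poly int},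
    (size f <= D)%N & x - ev f lam \in B k%:R) ->
  exists c : 'I_D -> C, (forall i, Qp v (c i)) /\ x = \sum_(i < D) c i * lam ^+ i.
Proof.
move=> h; have {h} /choice [f hf] : forall k : nat, exists f : {poly int},
    (size f <= D)%N /\ x - ev f lam \in B k%:R.
  by move=> k; have [g sg hg] := h k; exists g.
have step i k : ((f k.+1)`_i)%:~R - ((f k)`_i)%:~R \in B (k%:R * 1).
  rewrite mulr1 -rmorphB -coefB /=; apply: intr_ppow; apply: ev_ball_dvd.
    by rewrite (leq_trans (size_polyD _ _)) // geq_max size_polyN (hf k).1 (hf k.+1).1.
  rewrite rmorphB /= hornerD hornerN.
  have -> : ev (f k.+1) lam - ev (f k) lam =
    (x - ev (f k) lam) - (x - ev (f k.+1) lam) by ring.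
  apply: rpredB; first exact: (hf k).2.
  by apply: (vball_le _ (hf k.+1).2); rewrite ler_nat.
have /choice [c hc] : forall i : 'I_D, exists l, Qp v l /\
    forall k, ((f k)`_i)%:~R - l \in B k%:R.
  move=> i; have [l _ hl] := val_geo_cvg (hC := hC) ltr01 (step i); exists l.
  have hl' k : ((f k)`_i)%:~R - l \in B k%:R by have := hl k; rewrite mulr1.
  split => //; apply: (@Qp_closed _ _ _ _ hC) => r.
  exists (((f (Num.bound `|r|))`_i)%:~R).
    have := ratr_Qp hC (((f (Num.bound `|r|))`_i)%:~R).
    by rewrite -[ratr _]/(ratC hp hC _) rmorph_int.
  rewrite -opprB rpredN; apply: (vball_le _ (hl' _)).
  exact: le_trans (ler_norm _) (ltW (archi_boundP (normr_ge0 _))).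
exists c; split=> [i|]; first by case: (hc i).
apply/subr0_eq/(ball_all0 (hC := hC)) => A.
apply: (@vball_le _ _ _ _ hC A (Num.bound `|A|)%:R).
  exact: le_trans (ler_norm _) (ltW (archi_boundP (normr_ge0 _))).
set k := Num.bound _.
have -> : x - \sum_(i < D) c i * lam ^+ i =
    (x - ev (f k) lam) + \sum_(i < D) (((f k)`_i)%:~R - c i) * lam ^+ i.
  under [X in _ = _ + X]eq_bigr do rewrite mulrBl.
  by rewrite sumrB -(ev_wide (hf k).1); ring.
apply: rpredD; first exact: (hf k).2.
apply: rpred_sum => i _; apply: vballMr; first exact: (hc i).2.
by rewrite rpredX // lam_ring.
Qed.

Section Inversion.
Variables (x z : C).
Hypothesis vx : v x = r0%:E.
Hypothesis hz : forall N, (AHe hp hC N).[x] - z \in B (N%:R * r0).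
Hypothesis lamE : lam = z - 1.

(** Write x as lam minus the terms of degree at least 2 of E(x). An approximation of x
modulo lam^N gives these terms modulo lam^(N+1), as x and lam are in the
maximal ideal, and the coefficients of E are p-adic limits of integers. *)
Lemma AHexp_inverse N : exists f : {poly int}, x - ev f lam \in B (N%:R * r0).
Proof.
have r0p := r0_gt0.
have r01 : r0 <= 1 by rewrite invf_le1 ?ltr0n // ler1n.
have xB : x \in B r0 by rewrite BE vx.
elim: N => [|[|N] [f hf]].
- by exists 0; rewrite rmorph0 horner0 subr0 mul0r; apply: (vball_le (ltW r0p)).
- by exists 0; rewrite rmorph0 horner0 subr0 mul1r.
set y := ev f lam in hf; pose s : R := N.+2%:R * r0.
have yB : y \in B r0.
  have -> : y = x - (x - y) by ring.
  apply: rpredB => //; apply: (vball_le _ hf).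
  by rewrite -[X in X <= _]mul1r ler_wpM2r ?(ltW r0p) // ler1n.
have /choice [c hc] : forall k, exists c : nat,
    ratr (AHexp p k) - c%:R \in B N.+2%:R.
  by move=> k; apply: (Zp_approx hp) (AHexp_integral hp hC k); exact: ratr_Qp hC _.
exists ('X - \sum_(k < N) (c k.+2)%:Z *: f ^+ k.+2).
rewrite rmorphB /= map_polyX hornerD hornerN hornerX rmorph_sum horner_sum /=.
have -> : \sum_(i < N) (map_poly intr ((c i.+2)%:Z *: f ^+ i.+2)).[lam] =
          \sum_(i < N) (c i.+2)%:R * y ^+ i.+2.
  by apply: eq_bigr => i _; rewrite map_polyZ rmorphXn /= hornerZ horner_exp.
have e01 : ratr (AHexp p 0) = 1 :> C /\ ratr (AHexp p 1) = 1 :> C.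
  rewrite !AHexp_small ?prime_gt0 ?prime_gt1 // !factE invr1.
  by split; exact: (rmorph1 (ratC hp hC)).
have := hz N.+2; rewrite AHeE_horner !big_ord_recl /= e01.1 e01.2 expr0 expr1 !mul1r.
set S := \sum_(i < N) _ => hS.
set T := \sum_(i < N) _.
have -> : x - (lam - T) = (1 + (x + S) - z) + (T - S) by rewrite lamE; ring.
apply: rpredD => //; rewrite /T /S -sumrB; apply: rpred_sum => k _.
rewrite /bump /= !add1n; set a := ratr _; set b := (c k.+2)%:R.
have -> : b * y ^+ k.+2 - a * x ^+ k.+2 =
  - ((a - b) * y ^+ k.+2) - a * (x ^+ k.+2 - y ^+ k.+2) by ring.
have yO := vball_ring (ltW r0p) yB.
rewrite rpredB ?rpredN //.
  apply: vballMr; last exact: rpredX.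
  apply: (vball_le _ (hc k.+2)).
  by rewrite -[X in _ <= X]mulr1 ler_wpM2l ?ler0n.
apply: vballMl; first exact: AHexp_integral.
rewrite subrXX.
have : (x - y) * (\sum_(i < k.+2) x ^+ (k.+2.-1 - i) * y ^+ i)
    \in B (N.+1%:R * r0 + k.+1%:R * r0).
  apply: vballM => //; apply: rpred_sum => i _.
  have -> : k.+1%:R * r0 = (k.+1 - i)%N%:R * r0 + i%:R * r0.
    by rewrite -mulrDl -natrD subnK // -ltnS.
  by apply: vballM; apply: vballX.
apply: vball_le; rewrite -mulrDl ler_wpM2r ?(ltW r0p) // -natrD ler_nat; lia.
Qed.

Lemma AHexp_inverse_field (F : set C) (Phi : {poly int}) : is_subfield F ->
  Qp v `<=` F -> F z -> Phi \is monic -> size Phi = D.+1 -> ev Phi lam = 0 -> F x.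
Proof.
move=> hF QF zF Phi_monic sPhi Phi0.
have [|c [cQ ->]] := @eisenstein_limit x.
  move=> k; have [f hf] := AHexp_inverse (k * D).
  exists (Pdiv.CommonRing.rmodp f Phi).
    rewrite -ltnS -sPhi Pdiv.CommonRing.ltn_rmodp.
    by rewrite -size_poly_gt0 sPhi.
  have := hf; rewrite natrM -mulrA r0_D mulr1.
  rewrite {1}(Pdiv.RingMonic.rdivp_eq Phi_monic f) rmorphD rmorphM /=.
  by rewrite hornerD hornerM Phi0 mulr0 add0r.
apply/(subfield_predE hF); apply: rpred_sum => i _; apply: rpredM.
  by apply/(subfield_predE hF); exact: QF.
apply: rpredX; rewrite lamE; apply: rpredB; last exact: rpred1.
by apply/(subfield_predE hF).
Qed.
End Inversion.
End EisensteinCoordinates.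

(** For q a power of the prime p, this is the cyclotomic polynomial
1 + Y^q + ... + Y^((p-1)q) in Y = X + 1. *)
Lemma cyclotomic_prime_power (p q : nat) : (1 < p)%N -> (0 < q)%N ->
  exists Phi : {poly int}, [/\ Phi \is monic, size Phi = (p.-1 * q).+1
    & forall (K : fieldType) (z : K), z ^+ (p * q) = 1 -> z ^+ q != 1 ->
        (map_poly intr Phi).[z - 1] = 0].
Proof.
case: p => // p p1 q0; pose P : {poly int} := \sum_(j < p.+1) 'X^(j * q).
have [sP lP] : size P = (p * q).+1 /\ lead_coef P = 1.
  rewrite /P big_ord_recr /=; set S := \sum_(j < p) _.
  have sS : (size S < size ('X^(p * q) : {poly int}))%N.
    rewrite size_polyXn ltnS; apply: leq_trans (size_sum _ _ _) _.
    apply/bigmax_leqP => j _; rewrite size_polyXn.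
    by rewrite ltn_pmul2r.
  by rewrite addrC size_polyDl // lead_coefDl // size_polyXn lead_coefXn.
exists (P \Po ('X + 1%:P)); split.
- by rewrite monicE lead_coef_comp ?size_XaddC // lP lead_coefXaddC expr1n mulr1.
- by rewrite size_comp_poly2 ?size_XaddC.
move=> K z z1 zq; rewrite map_comp_poly horner_comp /= map_polyXaddC.
rewrite hornerD hornerX hornerC.
rewrite subrK; have := subrX1 (z ^+ q) p.+1.
rewrite -exprM mulnC z1 subrr => /esym/eqP; rewrite mulf_eq0 subr_eq0 (negPf zq) /=.
rewrite /P rmorph_sum horner_sum => /eqP e; rewrite -[RHS]e.
apply: eq_bigr => j _ /=.
by rewrite map_polyXn hornerXn -exprM mulnC.
Qed.

(** * Dwork's splitting of the additive character *)

Lemma coef_comp_scaleX (K : fieldType) (f : {poly K}) (c : K) i :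
  (f \Po (c *: 'X))`_i = f`_i * c ^+ i.
Proof.
rewrite comp_polyE coef_sum; under eq_bigr do rewrite exprZn !coefZ coefXn.
have [fi|fi] := ltnP i (size f); last first.
  rewrite nth_default // mul0r big1 // => j _.
  by rewrite gtn_eqF ?mulr0 // (leq_trans (ltn_ord j)).
rewrite (bigD1 (Ordinal fi)) //= eqxx mulr1 big1 ?addr0 // => j.
by rewrite -val_eqE /= eq_sym => /negPf ->; rewrite !mulr0.
Qed.

Section Splitting.
Variables (R : realType) (p : nat) (hp : prime p) (C : fieldType).
Variables (v : C -> \bar R) (hC : is_Cp v p).
Notation O := (vring hC).
Notation B := (vball hC).
Notation Q := (subfield_pred (Qp_subfield hp hC)).
Notation AHe := (AHe hp hC).
Notation AHC := (AHC hp hC).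

Lemma AHC_coef0 N : (AHC N)`_0 = 0.
Proof. by rewrite coef_map /= AHpoly_coef0 // rmorph0. Qed.

Lemma AHe_texp N : eqX N (AHe N) (texp N (AHC N)).
Proof. by rewrite -map_texp; apply/map_eqX/AHexp_polyE. Qed.

Lemma poly_ppow_ball (f : {poly C}) (s : R) :
  exists K : nat, p%:R ^+ K *: f \is a polyOver (B s).
Proof.
have /choice [c hc] : forall i, exists K : nat, p%:R ^+ K * f`_i \in B s.
  move=> i; have [t t0 ft] := some_ball hC f`_i.
  exists (Num.bound `|s + t|); have := vballM (ppow_ball hC (Num.bound `|s + t|)) ft.
  apply: vball_le; rewrite lerBrDr.
  exact: le_trans (ler_norm _) (ltW (archi_boundP (normr_ge0 _))).
exists (\max_(i < size f) c i); apply/polyOverP => i; rewrite coefZ.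
have [fi|fi] := ltnP i (size f); last by rewrite [f`_i]nth_default // mulr0 rpred0.
have ci : (c i <= \max_(i < size f) c i)%N by exact: (leq_bigmax (Ordinal fi)).
by rewrite -(subnK ci) exprD -mulrA vballMl // rpredX // natr_ring.
Qed.

(** Each of the finitely many f^k / k! becomes divisible by a high power of p after
multiplication by p^K. *)
Lemma texp_small N (f : {poly C}) (s : R) : exists K : nat, forall y, y \in O ->
  texp N.+1 ((p%:R ^+ K * y) *: f) - 1 \is a polyOver (B s).
Proof.
have /choice [c hc] : forall k, exists K : nat,
    p%:R ^+ K *: ((k`!%:R)^-1 *: f ^+ k) \is a polyOver (B s).
  by move=> k; exact: poly_ppow_ball.
pose K := \max_(k < N) c k.+1; exists K => y yO.
rewrite /texp big_ord_recl /= expr0 fact0 invr1 scale1r addrAC subrr add0r.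
apply: rpred_sum => k _; rewrite /bump add1n exprZn scalerA mulrC -scalerA.
have ck : (c k.+1 <= K)%N by exact: (leq_bigmax k).
have -> : (p%:R ^+ K * y) ^+ k.+1 =
  (p%:R ^+ K * y) ^+ k * y * p%:R ^+ (K - c k.+1) * p%:R ^+ (c k.+1) :> C.
  by rewrite -[RHS]mulrA -exprD subnK // exprSr -mulrA [y * _]mulrC.
rewrite -scalerA; apply/polyOverP => i; rewrite coefZ; apply: vballMl.
  by rewrite !(rpredM, rpredX) // natr_ring.
exact: (polyOverP (hc k.+1)).
Qed.

Variables (r : R) (r0 : 0 < r) (x z : C).
Hypothesis xr : x \in B r.
Hypothesis hz : forall N, (AHe N).[x] - z \in B (N%:R * r).
Variables (m : nat) (hm : (0 < m)%N).

(** The exponents of AH are powers p^s of p, and y |-> y^(p^s) permutes the conjugates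
of y. *)
Lemma AH_trace N (y : C) : y ^+ (p ^ m) = y ->
  \sum_(j < m) (AHC N \Po (y ^+ (p ^ j) *: 'X)) =
  (\sum_(j < m) y ^+ (p ^ j)) *: AHC N.
Proof.
move=> ym; apply/polyP => i; rewrite coef_sum coefZ.
under eq_bigr do rewrite coef_comp_scaleX.
rewrite -mulr_sumr mulrC.
have [[s ->]|h] := pselect (exists s, i = p ^ s)%N; last first.
  suff -> : (AHC N)`_i = 0 by rewrite !mulr0.
  rewrite coef_map coef_poly; case: ifP => _ /=; last exact: (rmorph0 (ratC hp hC)).
  rewrite AH_npow; first exact: (rmorph0 (ratC hp hC)).
  by move=> s; apply/eqP => e; apply: h; exists s.
congr (_ * _).
rewrite -(@orbit_big _ _ _ _ (fun u : C => u) p m s y ym).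
by apply: eq_bigr => j _; rewrite exprAC.
Qed.

(** The formal identity E(yX) E(y^p X) ... E(y^(p^(m-1)) X) = E(X)^t, with t the trace of
y and E(X)^t understood as exp(t AH(X)). *)
Lemma AHe_prod_trace N (y : C) : (0 < N)%N -> y ^+ (p ^ m) = y ->
  eqX N (\prod_(j < m) (AHe N \Po (y ^+ (p ^ j) *: 'X)))
        (texp N ((\sum_(j < m) y ^+ (p ^ j)) *: AHC N)).
Proof.
move=> N0 ym; rewrite -AH_trace //.
apply: eqX_trans (eqX_sym (texp_sum (@natC_neq0 _ _ hp _ _ hC) _ N0 _)); last first.
  by move=> j; rewrite coef_comp_scaleX AHC_coef0 mul0r.
apply: eqX_prod => j i iN; rewrite -texp_comp !coef_comp_scaleX.
by rewrite AHe_texp.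
Qed.

(** Evaluate E(yX) ... E(y^(p^(m-1)) X) = E(X)^t at x. With t = n + p^K u, the factor
exp(p^K u AH(X)) of the right-hand side is 1 up to coefficients of large valuation.
The evaluation of a congruence modulo X^N is legitimate because both sides have
integral coefficients. *)
Lemma dwork_splitting N : (0 < N)%N -> exists K : nat, forall (y : C) (n : nat),
  y \in O -> y ^+ (p ^ m) = y -> \sum_(j < m) y ^+ (p ^ j) - n%:R \in B K%:R ->
  \prod_(j < m) (AHe N).[y ^+ (p ^ j) * x] - z ^+ n \in B (N%:R * r).
Proof.
move=> N0; have s0 : 0 <= N%:R * r by rewrite mulr_ge0 ?ler0n ?(ltW r0).
have [K hK] : exists K : nat, forall u, u \in O ->
    texp N ((p%:R ^+ K * u) *: AHC N) - 1 \is a polyOver (B (N%:R * r)).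
  by case: N N0 {s0} => // N _; exact: texp_small.
exists K => y n yO ym; set t := \sum_(j < m) _ => ht.
have pK0 : (p%:R ^+ K : C) != 0 by rewrite expf_neq0 // (natC_neq0 hp hC) ?prime_gt0.
pose u := (t - n%:R) / p%:R ^+ K.
have uO : u \in O.
  have vp : v (p%:R ^+ K) = (K%:R * 1)%:E by apply: (val_expn hC); exact: (Cp_valp hC).
  have := vballM ht (_ : (p%:R ^+ K)^-1 \in B (- K%:R)); rewrite subrr -O_B0; apply.
  by rewrite BE (val_inv hC pK0 vp) mulr1.
have tE : t = n%:R + p%:R ^+ K * u by rewrite /u mulrC divfK // addrC subrK.
have xO : x \in O := vball_ring (ltW r0) xr.
pose F := \prod_(j < m) (AHe N \Po (y ^+ (p ^ j) *: 'X)).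
pose H := texp N ((p%:R ^+ K * u) *: AHC N).
have H1 : H - 1 \is a polyOver (B (N%:R * r)) := hK u uO.
have HO : H \is a polyOver O.
  have -> : H = (H - 1) + 1 by rewrite subrK.
  rewrite rpredD ?rpred1 //; apply/polyOverP => i.
  exact: vball_ring s0 (polyOverP H1 i).
have FO : F \is a polyOver O.
  apply: rpred_prod => j _; apply: polyOver_comp; first exact: AHe_ring.
  by rewrite polyOverZ ?polyOverX // rpredX.
have GO : AHe N ^+ n * H \is a polyOver O by rewrite rpredM // rpredX // AHe_ring.
have FG : eqX N F (AHe N ^+ n * H).
  apply: eqX_trans (AHe_prod_trace N0 ym) _; rewrite -/t tE scalerDl scaler_nat.
  have c0 := @natC_neq0 _ _ hp _ _ hC.
  apply: eqX_trans (texpD c0 _ _) _;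
    rewrite ?coefMn ?coefZ ?AHC_coef0 ?mul0rn ?mulr0 //.
  apply: eqXM => //; apply: eqX_trans (texpMn c0 _ N0 (AHC_coef0 N)) _.
  exact/eqX_exp/eqX_sym/AHe_texp.
have Fx : F.[x] = \prod_(j < m) (AHe N).[y ^+ (p ^ j) * x].
  by rewrite horner_prod; apply: eq_bigr => j _; rewrite horner_comp hornerZ hornerX.
rewrite -Fx; have FGx : F.[x] - (AHe N).[x] ^+ n * H.[x] \in B (N%:R * r).
  rewrite -horner_exp -hornerM -hornerN -hornerD (eqX_dvd FG) hornerM hornerXn.
  apply: vballMl; last exact: vballX.
  rewrite rpred_horner //; apply/polyOverP => i; rewrite coef_drop_poly.
  by apply: (polyOverP (_ : F - AHe N ^+ n * H \is a polyOver O)); rewrite rpredB.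
have eO : (AHe N).[x] \in O by rewrite rpred_horner // AHe_ring.
have zO : z \in O.
  have -> : z = (AHe N).[x] - ((AHe N).[x] - z) by ring.
  by rewrite rpredB // (vball_ring s0 (hz N)).
have -> : F.[x] - z ^+ n = (F.[x] - (AHe N).[x] ^+ n * H.[x])
    + (AHe N).[x] ^+ n * (H.[x] - 1) + ((AHe N).[x] ^+ n - z ^+ n) by ring.
apply: rpredD; [apply: rpredD => // | rewrite subrXX].
  apply: vballMl; first exact: rpredX.
  have := horner_ball H1 xO; by rewrite hornerD hornerN hornerC.
apply: vballMr => //; apply: rpred_sum => i _; apply: rpredM; exact: rpredX.
Qed.
End Splitting.

(** * The two characters and the expansion of the Gauss sum *)

Section Characters.
Variables (R : realType) (p : nat) (hp : prime p) (C : fieldType).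
Variables (v : C -> \bar R) (hC : is_Cp v p).
Notation O := (vring hC).
Notation B := (vball hC).
Notation Zp := (integers v (Qp v)).

Variables (psi : C -> C) (l : nat).
Hypothesis hpsi : add_character Zp psi.
Hypothesis hord : character_order Zp psi (p ^ l).

Lemma Zp_natr n : Zp n%:R.
Proof. by split; [exact: (Qp_natr hp hC) | exact: (natr_ring hC)]. Qed.

Lemma Zp_natmul n y : Zp y -> Zp (n%:R * y).
Proof.
move=> [yQ y0]; split; first exact/(QpM hp hC)/yQ/(Qp_natr hp hC).
have : n%:R * y \in O by rewrite rpredM ?natr_ring.
by [].
Qed.

Lemma add_char_natmul n y : Zp y -> psi (n%:R * y) = psi y ^+ n.
Proof.
move=> hy; elim: n => [|n IH].
  rewrite mul0r expr0; have h0 := Zp_natr 0.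
  apply: (mulfI (hpsi.1 _ h0)); rewrite mulr1 -hpsi.2 // addr0 //.
rewrite exprS -IH -hpsi.2 //; last exact: Zp_natmul.
by congr psi; rewrite -natr1; ring.
Qed.

Lemma add_char_order y : Zp y -> psi y ^+ (p ^ l) = 1.
Proof. by move=> hy; have [_ h] := hord; apply: (proj2 (h _)) (dvdnn _) y hy. Qed.

(** With t = n + p^L y and L >= l, psi(p^L y) = psi(y)^(p^L) = 1: a character
of order p^l is continuous. *)
Lemma add_char_approx t K : Zp t -> exists2 n : nat,
  psi t = psi 1 ^+ n & t - n%:R \in B K%:R.
Proof.
move=> [tQ t0]; have [n hn] := Zp_approx hp (maxn K l) tQ (t0 : t \in O).
have hnl : t - n%:R \in B l%:R by apply: (vball_le _ hn); rewrite ler_nat leq_maxr.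
exists n; last by apply: (vball_le _ hn); rewrite ler_nat leq_maxl.
have pl0 : (p%:R ^+ l : C) != 0 by rewrite expf_neq0 // (natC_neq0 hp hC) ?prime_gt0.
pose y := (t - n%:R) / p%:R ^+ l.
have hy : Zp y.
  split; last first.
    have vp : v (p%:R ^+ l) = (l%:R * 1)%:E by apply: (val_expn hC); exact: (Cp_valp hC).
    have := vballM hnl (_ : (p%:R ^+ l)^-1 \in B (- l%:R)); rewrite subrr -O_B0; apply.
    by rewrite BE (val_inv hC pl0 vp) mulr1.
  apply: (QpM hp hC); first exact/(QpB hp hC)/(Qp_natr hp hC).
  by apply: (QpV hp hC); rewrite -natrX; exact: (Qp_natr hp hC).
have -> : t = n%:R * 1 + (p ^ l)%:R * y by rewrite natrX mulr1 mulrC divfK // addrC subrK.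
have h1 : Zp 1 := Zp_natr 1.
rewrite hpsi.2; [|exact: Zp_natmul|exact: Zp_natmul].
by rewrite !add_char_natmul // add_char_order // mulr1.
Qed.

(** The values of psi are powers of psi(1), so psi has the order of psi(1). *)
Lemma add_char_primitive : (0 < l)%N ->
  psi 1 ^+ (p ^ l) = 1 /\ psi 1 ^+ (p ^ l.-1) != 1.
Proof.
move=> l0; split; first exact/add_char_order/(Zp_natr 1).
apply/eqP => e; have [_ h] := hord.
have : (p ^ l %| p ^ l.-1)%N.
  apply/h => t ht; have [n -> _] := add_char_approx 0 ht.
  by rewrite exprAC e expr1n.
by rewrite dvdn_Pexp2l ?prime_gt1 //; lia.
Qed.
End Characters.

Section GaussExpansion.
Variables (R : realType) (p : nat) (hp : prime p) (C : fieldType).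
Variables (v : C -> \bar R) (hC : is_Cp v p).
Notation O := (vring hC).
Notation B := (vball hC).
Variables (r : R) (r0 : 0 < r) (r1 : r <= 1) (x : C).
Hypothesis xr : x \in B r.
Variables (m : nat) (hm : (0 < m)%N) (w : C).
Hypothesis hw : (p ^ m - 1).-primitive_root w.
Notation n := (p ^ m - 1)%N.

Lemma AHe_prod_expand N (y : C) :
  \prod_(j < m) (AHe hp hC N).[y ^+ (p ^ j) * x] =
  \sum_(f : {ffun 'I_m -> 'I_N})
     (\prod_j ratr (AHexp p (f j))) * x ^+ (\sum_j f j) * y ^+ (\sum_j f j * p ^ j).
Proof.
under eq_bigr do rewrite AHeE_horner.
rewrite bigA_distr_bigA /=; apply: eq_bigr => f _.
rewrite -!prodrXr -!big_split /=; apply: eq_bigr => j _.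
by rewrite exprMn -exprM mulnC mulrA mulrAC.
Qed.

(** Summing over the roots of unity against y^(-a) selects the monomials whose exponent
in y is congruent to a modulo p^m - 1; the one of lowest degree in x is given by the
digits of a. The factor p^m - 1 is -1 modulo p, and v(p) = 1 >= r. *)
Lemma gauss_expand (a s : nat) (d : 'I_m -> nat) : (a < n)%N ->
  (forall i, d i < p)%N -> a = (\sum_(i < m) d i * p ^ i)%N ->
  s = (\sum_(i < m) d i)%N ->
  \sum_(i < n) (w ^+ i) ^- a *
      \prod_(j < m) (AHe hp hC s.+1).[(w ^+ i) ^+ (p ^ j) * x]
    + x ^+ s / (\prod_(i < m) (d i)`!)%:R \in B (s.+1%:R * r).
Proof.
move=> an hd aE sE.
have n0 : (0 < n)%N := n_gt0 hp hm.
(* [f] runs over the exponents (k_0, ..., k_(m-1)); [c f] is the coefficient and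
   [T f] the exponent of y in the corresponding monomial. *)
pose c (f : {ffun 'I_m -> 'I_s.+1}) : C :=
  (\prod_j ratr (AHexp p (f j))) * x ^+ (\sum_j f j).
pose T (f : {ffun 'I_m -> 'I_s.+1}) := (\sum_j f j * p ^ j)%N.
have -> : \sum_(i < n) (w ^+ i) ^- a *
      \prod_(j < m) (AHe hp hC s.+1).[(w ^+ i) ^+ (p ^ j) * x]
    = \sum_f c f * (if (n %| T f + (n - a))%N then n%:R else 0).
  under eq_bigr do rewrite AHe_prod_expand mulr_sumr.
  rewrite exchange_big; apply: eq_bigr => f _ /=.
  rewrite -(sum_prim_root _ hw) mulr_sumr; apply: eq_bigr => i _.
  rewrite [LHS]mulrC /c -!mulrA; congr (_ * (_ * _)); rewrite exprD; congr (_ * _).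
  have w0 : w ^+ i != 0.
    by apply: (val_neq0 hC (val_unity hC n0 (w_unity hw i))).
  apply: (mulfI (expf_neq0 a w0)); rewrite divff; last exact: expf_neq0.
  by rewrite -exprD subnKC ?(w_unity hw) // ltnW.
have dN : forall i0, (d i0 < s.+1)%N.
  by move=> i0; rewrite ltnS sE (bigD1 i0) //= leq_addr.
pose fd : {ffun 'I_m -> 'I_s.+1} := [ffun i => Ordinal (dN i)].
have fdE i : fd i = d i :> nat by rewrite ffunE.
have eO k : ratr (AHexp p k) \in O := AHexp_integral hp hC k.
have cO f : \prod_j ratr (AHexp p (f j)) \in O by rewrite rpred_prod.
have Tfd : T fd = a by rewrite aE; apply: eq_bigr => i _; rewrite fdE.
have sfd : (\sum_j fd j)%N = s by rewrite [RHS]sE; apply: eq_bigr => i _; rewrite fdE.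
have pd : \prod_j ratr (AHexp p (fd j)) = ((\prod_(i < m) (d i)`!)%:R)^-1 :> C.
  rewrite natr_prod -prodfV; apply: eq_bigr => i _.
  by rewrite fdE AHexp_small // -[ratr _]/(ratC hp hC _) fmorphV rmorph_nat.
rewrite (bigD1 fd) //= Tfd subnKC ?(ltnW an) // dvdnn addrAC; apply: rpredD.
  have -> : c fd * n%:R + x ^+ s / (\prod_(i < m) (d i)`!)%:R =
     (\prod_j ratr (AHexp p (fd j))) * (p%:R ^+ m * x ^+ s).
    rewrite /c pd sfd natrB ?expn_gt0 ?prime_gt0 // natrX; ring.
  apply: vballMl; first exact: cO.
  rewrite -natr1 mulrDl mul1r addrC; apply: vballM; last exact: vballX.
  apply: (vball_le _ (ppow_ball hC m)); apply: le_trans r1 _.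
  by rewrite ler1n.
apply: rpred_sum => f fn; case: ifP => [dv|_]; last by rewrite mulr0 rpred0.
have sf : (s < \sum_j f j)%N.
  rewrite ltnNge; apply: contra fn => sf; apply/eqP/ffunP => i; apply/val_inj.
  rewrite /= fdE.
  apply: (digit_sum_min (prime_gt1 hp) (d := d) (k := fun i => f i)) => //.
  - by rewrite -aE.
  - rewrite -aE; apply/eqP; rewrite -(eqn_modDr (n - a)) subnKC ?(ltnW an) // modnn.
    exact: dv.
  - by rewrite -sE.
apply: vballMr; last exact: natr_ring.
apply: vballMl; first exact: cO.
by apply: (vball_le _ (vballX _ xr)); rewrite ler_wpM2r ?(ltW r0) // ler_nat.
Qed.
End GaussExpansion.

Lemma Tstar_pow (R : realType) p (hp : prime p) (C : fieldType) (v : C -> \bar R)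
   (hC : is_Cp v p) m (hm : (0 < m)%N) w (hw : (p ^ m - 1).-primitive_root w) :
  Tstar p v m w = (fun i : nat => w ^+ i) @` `I_(p ^ m - 1).
Proof.
apply/seteqP; split=> y /=.
  by move=> [_ /(prim_rootP hw) [i ->]]; exists (i : nat).
move=> [i _ <-]; split; last exact: (w_unity hw).
split; first exact: K_wpow.
by rewrite (val_unity hC (n_gt0 hp hm) (w_unity hw i)).
Qed.

Lemma mul_char_id (R : realType) p (hp : prime p) (C : fieldType) (v : C -> \bar R)
   (hC : is_Cp v p) m (hm : (0 < m)%N) w zeta chi :
  mul_character (units v (Kunr v w)) chi ->
  range (fun k : nat => zeta ^+ k) = Tstar p v m w ->
  chi zeta = zeta -> forall y, Tstar p v m w y -> chi y = y.
Proof.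
move=> [chi0 chiM] hz cz.
have un y : Tstar p v m w y -> units v (Kunr v w) y.
  by move=> [[yK _] yn]; split=> //; exact: (val_unity hC (n_gt0 hp hm) yn).
have zT k : Tstar p v m w (zeta ^+ k) by rewrite -hz; exists k.
move=> y; rewrite -hz => -[k _ <-]; elim: k => [|k IH].
  have u1 := un _ (zT 0%N); rewrite expr0 in u1 *.
  by apply: (mulfI (chi0 _ u1)); rewrite -chiM // !mulr1.
rewrite exprS chiM ?IH ?cz //; last exact/un/zT.
by have := un _ (zT 1%N); rewrite expr1.
Qed.

(** * The congruence for Gauss sums *)

Theorem theorem2p1 (R : realType) (p : nat) (hp : prime p)
  (C : fieldType) (v : C -> \bar R) (hC : is_Cp v p)
  (pi_ : nat -> C) (hpi : compatible_roots p v pi_)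
  (l m : nat) (hl : (1 <= l)%N) (hm : (1 <= m)%N)
  (w : C) (hw : (p ^ m - 1).-primitive_root w)
  (psi : C -> C)
  (hpsi : add_character (integers v (Qp v)) psi)
  (hpsi_ord : character_order (integers v (Qp v)) psi (p ^ l))
  (hpsi1 : psi 1 = zeta_p p v pi_ l)
  (zeta : C) (hzeta : range (fun k : nat => zeta ^+ k) = Tstar p v m w)
  (chi : C -> C)
  (hchi : mul_character (units v (Kunr v w)) chi)
  (hchi_ord : character_order (units v (Kunr v w)) chi (p ^ m - 1))
  (hchi_zeta : chi zeta = zeta)
  (a : nat) (ha : (a <= p ^ m - 2)%N)
  (d : 'I_m -> nat) (hd : forall i, (d i <= p - 1)%N)
  (had : a = (\sum_(i < m) d i * p ^ i)%N) :
  let psi_lm := psi \o field_trace (Qp v) (Kunr v w) in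
  let s := (\sum_(i < m) d i)%N in
  let pa := (\prod_(i < m) (d i)`!)%N in
  congr_mod (integers v (Klm p v pi_ l w)) (pi_ l ^+ s.+1)
    (gauss_sum (Tstar p v m w) (fun x => chi x ^- a) psi_lm)
    (- (pi_ l ^+ s / pa%:R)).
Proof.
move=> psi_lm s pa.
have p1 := prime_gt1 hp.
set D := (p ^ l - p ^ l.-1)%N.
have DE : D = (p.-1 * p ^ l.-1)%N.
  by rewrite /D -{1}(prednK hl) expnS -{2}[(p ^ l.-1)%N]mul1n -mulnBl subn1.
have ppl0 : (0 < p ^ l.-1)%N by rewrite expn_gt0 prime_gt0.
have D0 : (0 < D)%N by rewrite DE muln_gt0 ppl0 andbT; case: (p) p1 => [|[]].
pose r : R := (D%:R)^-1; have r0 : 0 < r by rewrite invr_gt0 ltr0n.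
have r1 : r <= 1 by rewrite invf_le1 ?ltr0n // ler1n.
have [_ vx0 _] := hpi.2 l hl; set x := pi_ l in vx0 *.
have vx : v x = r%:E := vx0.
have xr : x \in vball hC r by rewrite BE vx.
pose z := zeta_p p v pi_ l.
have hz N : (AHe hp hC N).[x] - z \in vball hC (N%:R * r) by exact: zeta_approx.
have [zpl zpl1] := add_char_primitive hp hC hpsi hpsi_ord hl.
rewrite hpsi1 -/z in zpl zpl1.
(* E(X) = 1 + X modulo X^2, hence zeta - 1 and pi_l have the same valuation. *)
have vlam : v (z - 1) = r%:E.
  rewrite -[r%:E]vx; apply: (val_perturb hC).
  have := hz 2; rewrite AHeE_horner !big_ord_recl big_ord0 !AHexp_small ?prime_gt0 //=.
  rewrite !factE !invr1 /= expr0 expr1 addr0 -[ratr 1]/(ratC hp hC 1) rmorph1 !mul1r.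
  have -> : 1 + x - z = x - (z - 1) by ring.
  by rewrite BE vx; apply: lt_le_trans; rewrite lte_fin; lra.
pose F := Klm p v pi_ l w.
have F_sub : is_subfield F by exact: is_subfield_smallest.
have Omega_F : Omega p v pi_ l `<=` F by move=> y hy A [_]; apply; left.
have K_F : Kunr v w `<=` F by move=> y hy A [_]; apply; right.
have Qp_F : Qp v `<=` F by move=> y hy; apply: K_F; exact: Qp_sub_K.
have zF : F z by apply: Omega_F => A [_]; apply; right.
have xF : F x.
  have [Phi [Phi1 Phi2 Phi3]] := cyclotomic_prime_power p1 ppl0.
  apply: (AHexp_inverse_field D0 vlam vx hz erefl F_sub Qp_F zF Phi1) => //.
    by rewrite Phi2 DE.
  by apply: Phi3 => //; rewrite -expnS prednK.
have wF i : F (w ^+ i) by apply: K_F; exact: K_wpow.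
pose n := (p ^ m - 1)%N; have n0 : (0 < n)%N := n_gt0 hp hm.
have d_lt i : (d i < p)%N.
  by apply: leq_ltn_trans (hd i) _; rewrite subn1 prednK ?prime_gt0.
have an : (a < n)%N by rewrite /n; have := q_gt1 hp hm; lia.
have tr_Zp (i : nat) : integers v (Qp v) (field_trace (Qp v) (Kunr v w) (w ^+ i)).
  rewrite (@field_trace_wpow _ _ hp _ _ hC _ hm _ hw); split.
    apply/(subfield_predE (Qp_subfield hp hC)).
    have := @orbit_sum_Q _ _ hp _ _ hC _ hm _ hw _ (polyOverXn _ i).
    under eq_bigr do rewrite hornerXn exprAC.
    by apply.
  have : \sum_(j < m) (w ^+ i) ^+ (p ^ j) \in vring hC.
    by apply: rpred_sum => j _; rewrite rpredX // (w_ring hp hC hm hw).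
  by [].
(* Modulo pi_l^(s+1), the terms of E of degree at most s suffice. *)
have [K hK] := dwork_splitting r0 xr hz m (ltn0Sn s).
have psiE (i : nat) : exists2 k : nat, psi_lm (w ^+ i) = z ^+ k &
    \prod_(j < m) (AHe hp hC s.+1).[(w ^+ i) ^+ (p ^ j) * x] - z ^+ k
      \in vball hC (s.+1%:R * r).
  have [k hk1 hk2] := add_char_approx hp hC hpsi hpsi_ord K (tr_Zp i).
  exists k; first by rewrite /psi_lm /= hk1 hpsi1.
  apply: hK; first exact: (w_ring hp hC hm hw).
    exact: (unity_pm hp hm (w_unity hw i)).
  by move: hk2; rewrite (@field_trace_wpow _ _ hp _ _ hC _ hm _ hw).
have GE : gauss_sum (Tstar p v m w) (fun y => chi y ^- a) psi_lm =
    \sum_(i < n) (w ^+ i) ^- a * psi_lm (w ^+ i).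
  rewrite /gauss_sum (eq_fsbigr (fun y => y ^- a * psi_lm y)); last first.
    by move=> y /set_mem hy; rewrite (mul_char_id hp hC hm hchi hzeta hchi_zeta hy).
  rewrite (Tstar_pow hp hC hm hw) fsbig_image -?fsbig_ord //.
  move=> i j /set_mem /= ilt /set_mem /= jlt /eqP.
  by rewrite (eq_prim_root_expr hw) !modn_small // => /eqP.
set G := gauss_sum _ _ _ in GE *.
have GF : F G.
  rewrite GE; apply/(subfield_predE F_sub); apply: rpred_sum => i _; have [k -> _] := psiE i.
  apply: rpredM; first by apply/rpredVr/rpredX/(subfield_predE F_sub).
  by apply/rpredX/(subfield_predE F_sub).
have sr0 : 0 <= s.+1%:R * r by rewrite mulr_ge0 ?ler0n ?(ltW r0).
have wiO (i : nat) : (w ^+ i) ^- a \in vring hC.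
  apply: (unity_ring hC n0 (x := (w ^+ i) ^- a)).
  by rewrite exprVn [_ ^+ a ^+ _]exprAC (w_unity hw) expr1n invr1.
have zO : z \in vring hC.
  by apply: (unity_ring hC (n := (p ^ l)%N)); rewrite ?expn_gt0 ?prime_gt0.
have GO : G \in vring hC.
  rewrite GE; apply: rpred_sum => i _; have [k -> _] := psiE i.
  by apply: rpredM => //; exact: rpredX.
have key : G + x ^+ s / pa%:R \in vball hC (s.+1%:R * r).
  have := gauss_expand hp r0 r1 xr hm hw an d_lt had (erefl s).
  set S := \sum_(_ < _) _ => hS.
  have -> : G + x ^+ s / pa%:R = (G - S) + (S + x ^+ s / pa%:R) by ring.
  apply: rpredD => //; rewrite GE /S -sumrB; apply: rpred_sum => i _.
  rewrite -mulrBr; apply: vballMl => //; have [k -> hk] := psiE i.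
  by rewrite -opprB rpredN.
have xsF : F (x ^+ s / pa%:R).
  apply/(subfield_predE F_sub); apply: rpredM; last by rewrite rpredV rpred_nat.
  by apply/rpredX/(subfield_predE F_sub).
have x0 : x != 0 := val_neq0 hC vx.
split.
- by split.
- split; first by apply/(subfield_predE F_sub); rewrite rpredN; apply/(subfield_predE F_sub).
  have : - (x ^+ s / pa%:R) \in vring hC.
    have -> : - (x ^+ s / pa%:R) = G - (G + x ^+ s / pa%:R) by ring.
    by rewrite rpredB // (vball_ring sr0 key).
  by [].
exists ((G + x ^+ s / pa%:R) / x ^+ s.+1); last first.
  by rewrite opprK [RHS]mulrC divfK // expf_neq0.
split.
  apply/(subfield_predE F_sub); apply: rpredM.
    by apply: rpredD; apply/(subfield_predE F_sub).
  by rewrite rpredV; apply/rpredX/(subfield_predE F_sub).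
have xs0 : x ^+ s.+1 != 0 by rewrite expf_neq0.
have := vballM key (_ : (x ^+ s.+1)^-1 \in vball hC (- (s.+1%:R * r))).
rewrite subrr -O_B0; apply.
by rewrite BE (val_inv hC xs0 (val_expn hC _ vx)).
Qed.
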